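(* Assume that the generating functions $g_\theta(z)$ and $g_\kappa(z)$ both have radius of convergence $R>0$, and that $1<g_\kappa^{\{1\}}(R)\le\infty$. Let $f$ be holomorphic in the open disk $|z|<R$. Then, uniformly in $v\in[v_1,v_2]$ for arbitrary constants $v_2>1>v_1>1/g_\kappa^{\{1\}}(R)$, $$[z^N]\big[f(z)\exp\{vG_N(z)\}\big]\sim\frac{f(r_v)\exp\{vG_N(r_v)\}}{r_v^N\sqrt{2\pi Nv\,b_2(r_v)}},\qquad N\to\infty.$$ In particular, $H_N\sim\dfrac{\exp\{g_\theta(r_1)+Ng_\kappa(r_1)\}}{r_1^N\sqrt{2\pi N b_2(r_1)}}$ as $N\to\infty$.
   Context: $(\theta_j)_{j\ge1}$, $(\kappa_j)_{j\ge1}$ are sequences of nonnegative reals; $g_\theta(z)=\sum_{j\ge1}\theta_jz^j/j$, $g_\kappa(z)=\sum_{j\ge1}\kappa_jz^j/j$, $G_N(z)=g_\theta(z)+Ng_\kappa(z)$. $[z^N]F(z)$ denotes the coefficient of $z^N$ in the power series of $F$. $H_N=\frac1{N!}\sum_{\sigma\in S_N}\prod_{j=1}^N(\theta_j+N\kappa_j)^{C_j(\sigma)}$, where $C_j(\sigma)$ is the number of $j$-cycles of the permutation $\sigma$. For a function $g$, $g^{\{n\}}(z)=z^ng^{(n)}(z)$; $g_\kappa^{\{n\}}(R):=\lim_{r\uparrow R}g_\kappa^{\{n\}}(r)\in[0,\infty]$. $b_2(r)=g_\kappa^{\{1\}}(r)+g_\kappa^{\{2\}}(r)$. For $v\ge1/g_\kappa^{\{1\}}(R)$,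 $r_v\in(0,R]$ is the unique solution of $g_\kappa^{\{1\}}(r)=1/v$. Standing assumption: $(\kappa_j)$ is non-arithmetic (there is no integer $j_0>1$ such that $\kappa_j\neq0$ implies $j_0\mid j$) and $\kappa_j>0$ for some $j\ge2$. ''Uniformly'' means the ratio of the two sides tends to $1$ uniformly in $v$.
   Formalization: The asymptotic for f is stated under the added condition that f(r_v) ≠ 0 for all v in [v_1,v_2]; without it the right-hand side vanishes and the ratio is undefined (e.g. f(z) = z − r_1 at v = 1). *)

(* Defs.v *)
From Stdlib Require Import Reals.
From Coquelicot Require Import Coquelicot.
From mathcomp Require Import ssreflect ssrbool ssrfun eqtype ssrnat seq
  choice fintype finset fingroup perm.

Set Implicit Arguments.
Unset Strict Implicit.

Definition gcoef (a : nat -> R) (j : nat) : R :=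
  match j with O => 0%R | S _ => (a j / INR j)%R end.

Definition gfun (a : nat -> R) (x : R) : R := PSeries (gcoef a) x.

Definition gbr1 (a : nat -> R) (x : R) : R := (x * Derive (gfun a) x)%R.
Definition gbr2 (a : nat -> R) (x : R) : R := (x ^ 2 * Derive_n (gfun a) 2 x)%R.

Definition b2 (kappa : nat -> R) (r : R) : R := (gbr1 kappa r + gbr2 kappa r)%R.

Definition GN (theta kappa : nat -> R) (N : nat) (x : R) : R :=
  (gfun theta x + INR N * gfun kappa x)%R.

Definition Rbar_at_left (Rr : Rbar) : (R -> Prop) -> Prop :=
  match Rr with
  | Rbar.Finite r => at_left r
  | p_infty => Rbar_locally p_infty
  | m_infty => Rbar_locally m_infty
  end.

Definition non_arithmetic (kappa : nat -> R) : Prop :=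
  ~ (exists j0 : nat, (1 < j0)%coq_nat /\
       forall j : nat, (1 <= j)%coq_nat -> kappa j <> 0%R -> Nat.divide j0 j).

(** Formal power series (coefficient sequences): Cauchy product, powers,
    and exponential of a series with zero constant term
    exp(c) = sum_m c^m / m!  (coefficient n only receives terms m <= n). *)
Definition ps_mul (a b : nat -> R) (n : nat) : R :=
  sum_f_R0 (fun i => (a i * b (n - i)%coq_nat)%R) n.

Fixpoint ps_pow (c : nat -> R) (m : nat) : nat -> R :=
  match m with
  | O => fun n => match n with O => 1%R | S _ => 0%R end
  | S m' => ps_mul c (ps_pow c m')
  end.

Definition ps_exp (c : nat -> R) (n : nat) : R :=
  sum_f_R0 (fun m => (ps_pow c m n / INR (Factorial.fact m))%R) n.

Definition vGN_coef (theta kappa : nat -> R) (N : nat) (v : R) (j : nat) : R :=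
  (v * (gcoef theta j + INR N * gcoef kappa j))%R.

(** A function holomorphic in |z| < R, given by its Taylor coefficients a_k,
    evaluated at a real point x. *)
Definition fval (a : nat -> C) (x : R) : C :=
  (Series (fun k => (fst (a k) * x ^ k)%R), Series (fun k => (snd (a k) * x ^ k)%R)).

Definition coefN (a : nat -> C) (theta kappa : nat -> R) (N : nat) (v : R) : C :=
  sum_n (fun k => Cmult (a k) (RtoC (ps_exp (vGN_coef theta kappa N v) (N - k)%coq_nat))) N.

Definition ncycles (N : nat) (s : 'S_N) (j : nat) : nat :=
  #|[set X in porbits s | #|X| == j]|.

Definition HN (theta kappa : nat -> R) (N : nat) : R :=
  (/ INR (Factorial.fact N) *
   foldr Rplus 0%R
     (map (fun s : 'S_N =>
        foldr Rmult 1%R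
          (map (fun j => (theta j + INR N * kappa j) ^ (ncycles s j))%R
               (iota 1 N)))
        (enum 'S_N)))%R.

(* Main.v *)
(* The coefficient is a Cauchy integral over the circle of radius r = r_v, on which the phase
   v g_kappa(r e^{it}) - v g_kappa(r) - it has no linear term.  Because the gcd of the support of
   kappa is 1, its real part is at most -c t^2 on all of [-pi, pi], uniformly for r in a compact
   subinterval of (0, R).  So the integrand and its Gaussian model differ by at most
   C t exp(-c' N t^2) on the whole circle, with no cut-off near t = 0, and the relative error
   is O(1/sqrt N) with a constant depending only on the compact range of r.
   The coefficients of f are treated through their real and imaginary parts, so that only real
   Fourier series are needed.  For H_N, summing over the permutations by deleting the successor
   of a marked point gives the recursion n e_n = sum_j x_j e_{n-j} of the coefficients of
   exp(sum_j x_j z^j / j). *)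
Require Import Defs.
From Stdlib Require Import Reals Lra Lia Factorial Classical PeanoNat Wf_nat.
From Coquelicot Require Import Coquelicot.
From mathcomp Require perm ssralg ssrnum poly Rstruct.
Local Open Scope R_scope.

(** * Fourier series with absolutely summable coefficients *)

(** The relative error is reached through an additive one: the coefficient divided by the
    exponential normalization is compared with f(r), separately for the real and the imaginary part,
    since either of them may vanish. Division by f(r_v) comes last and requires a lower bound of |f|
    on the whole range of radii. Uniformity in v becomes uniformity in r = r_v. Dilation of the
    coefficients by r^k moves the circle of integration to the unit circle, where r enters only
    through moments and a decay constant, and these are monotone in r. The phase differs from its
    quadratic model by O(t + N t^3): the t comes from g_theta, the N t^3 from N g_kappa. Half of the
    exponential decay absorbs N t^2, and the remaining integral of t exp(-c' N t^2) is O(1/N),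
    against a main term of order 1/sqrt N. The decay constant is explicit rather than obtained by
    compactness: a division argument on the support of kappa bounds |sin(t/2)| by a multiple of the
    square root of the real part lost at angle t. *)

Definition summable (c : nat -> R) := ex_series (fun k => Rabs (c k)).

Definition cosS (c : nat -> R) (t : R) := Series (fun k => c k * cos (INR k * t)).
Definition sinS (c : nat -> R) (t : R) := Series (fun k => c k * sin (INR k * t)).
Definition fourier (c : nat -> R) (t : R) : C := (cosS c t, sinS c t).

Lemma summable_le (a b : nat -> R) :
  (forall n, Rabs (a n) <= b n) -> ex_series b -> summable a.
Proof.
intros H Hb; apply (ex_series_le (fun k => Rabs (a k)) b); auto.
intros n; unfold norm; simpl; unfold abs; simpl; rewrite Rabs_Rabsolu; auto.
Qed.

Lemma Rabs_mul_le (x y : R) : Rabs y <= 1 -> Rabs (x * y) <= Rabs x.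
Proof.
intros H; rewrite Rabs_mult.
pose proof (Rabs_pos x); nra.
Qed.

Lemma Rabs_cos_le (x : R) : Rabs (cos x) <= 1.
Proof. apply Rabs_le; apply COS_bound. Qed.

Lemma Rabs_sin_le (x : R) : Rabs (sin x) <= 1.
Proof. apply Rabs_le; apply SIN_bound. Qed.

Lemma summable_cos (c : nat -> R) (t : R) :
  summable c -> summable (fun k => c k * cos (INR k * t)).
Proof.
intros H; apply summable_le with (2 := H); intros n.
apply Rabs_mul_le, Rabs_cos_le.
Qed.

Lemma summable_sin (c : nat -> R) (t : R) :
  summable c -> summable (fun k => c k * sin (INR k * t)).
Proof.
intros H; apply summable_le with (2 := H); intros n.
apply Rabs_mul_le, Rabs_sin_le.
Qed.

Lemma summable_ex (c : nat -> R) : summable c -> ex_series c.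
Proof. exact (ex_series_Rabs c). Qed.

Lemma summable_scal (x : R) (c : nat -> R) :
  summable c -> summable (fun k => x * c k).
Proof.
intros H; apply summable_le with (fun k => Rabs x * Rabs (c k)).
- intros n; rewrite Rabs_mult; lra.
- exact (ex_series_scal (V := R_NormedModule) (Rabs x) _ H).
Qed.

Lemma summable_plus (a b : nat -> R) :
  summable a -> summable b -> summable (fun k => a k + b k).
Proof.
intros Ha Hb; apply summable_le with (fun k => Rabs (a k) + Rabs (b k)).
- intros n; apply Rabs_triang.
- exact (ex_series_plus (V := R_NormedModule) _ _ Ha Hb).
Qed.

Lemma ps_mul_series (a b : nat -> R) : summable a -> summable b ->
  is_series (ps_mul a b) (Series a * Series b).
Proof.
intros Ha Hb; apply is_series_mult; auto; apply Series_correct, summable_ex; auto.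
Qed.

Lemma summable_mul (a b : nat -> R) :
  summable a -> summable b -> summable (ps_mul a b).
Proof.
intros Ha Hb.
apply summable_le with (ps_mul (fun k => Rabs (a k)) (fun k => Rabs (b k))).
- intros n; unfold ps_mul.
  eapply Rle_trans; [apply Rsum_abs|].
  apply sum_Rle; intros k _; rewrite Rabs_mult; lra.
- eexists; apply ps_mul_series.
  + apply summable_le with (2 := Ha); intros; rewrite Rabs_Rabsolu; lra.
  + apply summable_le with (2 := Hb); intros; rewrite Rabs_Rabsolu; lra.
Qed.

Lemma cosS_mul (a b : nat -> R) (t : R) : summable a -> summable b ->
  cosS (ps_mul a b) t = cosS a t * cosS b t - sinS a t * sinS b t.
Proof.
intros Ha Hb.
pose proof (summable_cos a t Ha) as Hac; pose proof (summable_cos b t Hb) as Hbc.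
pose proof (summable_sin a t Ha) as Has; pose proof (summable_sin b t Hb) as Hbs.
pose proof (ps_mul_series _ _ Hac Hbc) as H1.
pose proof (ps_mul_series _ _ Has Hbs) as H2.
apply is_series_unique.
eapply is_series_ext; [|exact (is_series_minus (V := R_NormedModule) _ _ _ _ H1 H2)].
intros n; unfold ps_mul; cbv [minus plus opp]; simpl.
rewrite Rmult_comm, scal_sum.
match goal with |- ?x + - ?y = _ =>
  change (x - y = sum_f_R0 (fun i => a i * b (n - i)%nat * cos (INR n * t)) n) end.
rewrite <- minus_sum.
apply sum_eq; intros i Hi.
replace (INR n * t) with (INR i * t + INR (n - i) * t)
  by (rewrite minus_INR by lia; ring).
rewrite cos_plus; ring.
Qed.

Lemma sinS_mul (a b : nat -> R) (t : R) : summable a -> summable b ->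
  sinS (ps_mul a b) t = cosS a t * sinS b t + sinS a t * cosS b t.
Proof.
intros Ha Hb.
pose proof (summable_cos a t Ha) as Hac; pose proof (summable_cos b t Hb) as Hbc.
pose proof (summable_sin a t Ha) as Has; pose proof (summable_sin b t Hb) as Hbs.
pose proof (ps_mul_series _ _ Hac Hbs) as H1.
pose proof (ps_mul_series _ _ Has Hbc) as H2.
apply is_series_unique.
eapply is_series_ext; [|exact (is_series_plus (V := R_NormedModule) _ _ _ _ H1 H2)].
intros n; unfold ps_mul; cbv [plus]; simpl.
rewrite Rmult_comm, scal_sum.
match goal with |- ?x + ?y = _ =>
  change (x + y = sum_f_R0 (fun i => a i * b (n - i)%nat * sin (INR n * t)) n) end.
rewrite <- plus_sum.
apply sum_eq; intros i Hi.
replace (INR n * t) with (INR i * t + INR (n - i) * t)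
  by (rewrite minus_INR by lia; ring).
rewrite sin_plus; ring.
Qed.

Lemma fourier_mul (a b : nat -> R) (t : R) : summable a -> summable b ->
  fourier (ps_mul a b) t = Cmult (fourier a t) (fourier b t).
Proof.
intros Ha Hb; unfold fourier, Cmult; simpl.
rewrite cosS_mul, sinS_mul; auto; f_equal; ring.
Qed.

Lemma is_series_finite (c : nat -> R) (n : nat) :
  (forall k, (n < k)%nat -> c k = 0) -> is_series c (sum_n c n).
Proof.
intros H; apply filterlim_ext_loc with (fun _ : nat => sum_n c n).
- exists n; intros m Hm; induction Hm as [|m Hm IH]; [reflexivity|].
  rewrite sum_Sn, <- IH, (H (S m)) by lia.
  symmetry; exact (plus_zero_r (G := R_AbelianGroup) _).
- apply filterlim_const.
Qed.

Lemma summable_finite (c : nat -> R) (n : nat) :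
  (forall k, (n < k)%nat -> c k = 0) -> summable c.
Proof.
intros H; eexists; apply is_series_finite with (n := n).
intros k Hk; rewrite H by auto; apply Rabs_R0.
Qed.

Lemma summable_pow (c : nat -> R) (m : nat) : summable c -> summable (ps_pow c m).
Proof.
intros H; induction m; simpl.
- apply summable_finite with O; intros [|k]; [lia|auto].
- apply summable_mul; auto.
Qed.

Lemma fourier_one (c : nat -> R) (t : R) : fourier (ps_pow c 0) t = RtoC 1.
Proof.
unfold fourier, cosS, sinS, RtoC; f_equal; apply is_series_unique.
- replace 1 with (sum_n (fun k => ps_pow c 0 k * cos (INR k * t)) 0).
  + apply is_series_finite; intros [|k] Hk; [lia|simpl; ring].
  + rewrite sum_O; simpl; rewrite Rmult_0_l, cos_0; ring.
- replace 0 with (sum_n (fun k => ps_pow c 0 k * sin (INR k * t)) 0).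
  + apply is_series_finite; intros [|k] Hk; [lia|simpl; ring].
  + rewrite sum_O; simpl; rewrite Rmult_0_l, sin_0; ring.
Qed.

Lemma fourier_pow (c : nat -> R) (m : nat) (t : R) : summable c ->
  fourier (ps_pow c m) t = Cpow (fourier c t) m.
Proof.
intros H; induction m.
- apply fourier_one.
- simpl; rewrite fourier_mul by (auto; apply summable_pow; auto).
  rewrite IHm; reflexivity.
Qed.

(** * The complex exponential and the exponential of a power series *)

(** Taylor polynomials of [exp (s z)], split into real and imaginary parts; the real parameter [s]
    lets the mean value theorem on [[0, 1]] replace complex differentiation. *)
Definition exp_part_re (z : C) (s : R) (M : nat) :=
  sum_f_R0 (fun m => fst (Cpow z m) / INR (fact m) * s ^ m) M.
Definition exp_part_im (z : C) (s : R) (M : nat) :=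
  sum_f_R0 (fun m => snd (Cpow z m) / INR (fact m) * s ^ m) M.

(** Differentiation lowers the degree by one, so the derivative is [z] times the polynomial minus
    the top term [z^(M+1) s^M / M!]. *)
Lemma exp_part_derive (z : C) (s : R) (M : nat) :
  is_derive (fun s => exp_part_re z s M) s
    (fst z * exp_part_re z s M - snd z * exp_part_im z s M
     - fst (Cpow z (S M)) / INR (fact M) * s ^ M) /\
  is_derive (fun s => exp_part_im z s M) s
    (snd z * exp_part_re z s M + fst z * exp_part_im z s M
     - snd (Cpow z (S M)) / INR (fact M) * s ^ M).
Proof.
induction M as [|M [IH1 IH2]].
- unfold exp_part_re, exp_part_im; simpl.
  split; eapply is_derive_ext; try (intros t; reflexivity); auto_derive; auto; field.
- assert (HM : INR (fact (S M)) = INR (S M) * INR (fact M)) by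
    (rewrite fact_simpl, mult_INR; auto).
  pose proof (INR_fact_neq_0 M); pose proof (not_0_INR (S M) ltac:(lia)).
  assert (Hd : forall x : R, is_derive (fun s : R => x / INR (fact (S M)) * s ^ S M) s
                 (x / INR (fact M) * s ^ M)).
  { intros x.
    replace (x / INR (fact M) * s ^ M) with (x / INR (fact (S M)) * (INR (S M) * s ^ M))
      by (rewrite HM; field; auto).
    generalize (x / INR (fact (S M))); intros c.
    auto_derive; [auto|simpl; ring]. }
  clear HM.
  split.
  + evar_last; [exact (is_derive_plus (V := R_NormedModule) _ _ _ _ _ IH1 (Hd _))|].
    unfold exp_part_re, exp_part_im; cbv [plus]; simpl; unfold Rdiv; ring.
  + evar_last; [exact (is_derive_plus (V := R_NormedModule) _ _ _ _ _ IH2 (Hd _))|].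
    unfold exp_part_re, exp_part_im; cbv [plus]; simpl; unfold Rdiv; ring.
Qed.

Lemma exp_part_0 (z : C) (M : nat) : exp_part_re z 0 M = 1 /\ exp_part_im z 0 M = 0.
Proof.
unfold exp_part_re, exp_part_im; induction M as [|M [IH1 IH2]].
- simpl; split; field.
- simpl sum_f_R0; rewrite IH1, IH2; simpl; split; ring.
Qed.

Lemma Cpow_re_im_le (z : C) (n : nat) :
  Rabs (fst (Cpow z n)) <= Cmod z ^ n /\ Rabs (snd (Cpow z n)) <= Cmod z ^ n.
Proof.
rewrite <- Cmod_pow; pose proof (Rmax_Cmod (Cpow z n)) as H.
split; (eapply Rle_trans; [|exact H]); [apply Rmax_l|apply Rmax_r].
Qed.

Lemma increment_bound (f df : R -> R) (B : R) :
  (forall s, 0 <= s <= 1 -> is_derive f s (df s)) ->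
  (forall s, 0 <= s <= 1 -> Rabs (df s) <= B) -> Rabs (f 1 - f 0) <= B.
Proof.
intros Hd HB.
destruct (MVT_gen f 0 1 df) as [c [Hc E]].
- intros x Hx; rewrite Rmin_left, Rmax_right in Hx by lra; apply Hd; lra.
- intros x Hx; rewrite Rmin_left, Rmax_right in Hx by lra.
  apply continuity_pt_filterlim, (ex_derive_continuous f); eexists; apply Hd; lra.
- rewrite Rmin_left, Rmax_right in Hc by lra.
  rewrite E; replace (df c * (1 - 0)) with (df c) by ring; auto.
Qed.

Lemma rotation_bound (a b c d B : R) : Rabs a <= 1 -> Rabs b <= 1 ->
  Rabs c <= B -> Rabs d <= B -> Rabs (a * c + b * d) <= 2 * B.
Proof.
intros Ha Hb Hc Hd.
eapply Rle_trans; [apply Rabs_triang|]; rewrite !Rabs_mult.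
pose proof (Rabs_pos a); pose proof (Rabs_pos b).
pose proof (Rabs_pos c); pose proof (Rabs_pos d); nra.
Qed.

(* The derivative of [s |-> exp (- s z) * sum_(m <= M) (s z)^m / m!] is the single
   term [- z exp (- s z) (s z)^M / M!]. *)
Lemma exp_part_twisted_bound (z : C) (M : nat) :
  let B := exp (Cmod z) * (2 * (Cmod z ^ S M / INR (fact M))) in
  Rabs (exp (- fst z) * (cos (snd z) * exp_part_re z 1 M
                         + sin (snd z) * exp_part_im z 1 M) - 1) <= B /\
  Rabs (exp (- fst z) * (cos (snd z) * exp_part_im z 1 M
                         - sin (snd z) * exp_part_re z 1 M)) <= B.
Proof.
intros B.
set (x := fst z); set (y := snd z).
pose proof (exp_part_0 z M) as [p0 q0].
assert (Hbd : forall w : R, Rabs w <= Cmod z ^ S M -> forall s, 0 <= s <= 1 ->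
   Rabs (w / INR (fact M) * s ^ M) <= Cmod z ^ S M / INR (fact M)).
{ intros w Hw s Hs; unfold Rdiv; rewrite !Rabs_mult.
  pose proof (INR_fact_lt_0 M).
  rewrite (Rabs_pos_eq (/ _)) by (left; apply Rinv_0_lt_compat; auto).
  assert (0 <= s ^ M <= 1).
  { split; [apply pow_le; lra|]; rewrite <- (pow1 M); apply pow_incr; lra. }
  rewrite (Rabs_pos_eq (s ^ M)) by lra.
  assert (0 < / INR (fact M)) by (apply Rinv_0_lt_compat; auto).
  assert (0 <= Rabs w * / INR (fact M)) by (apply Rmult_le_pos; [apply Rabs_pos|lra]).
  apply Rle_trans with (Rabs w * / INR (fact M)); [nra|].
  apply Rmult_le_compat_r; lra. }
pose proof (Cpow_re_im_le z (S M)) as [Hre Him].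
assert (Hexp : forall s, 0 <= s <= 1 -> exp (- (s * x)) <= exp (Cmod z)).
{ intros s Hs; destruct (Rle_lt_dec (- (s * x)) (Cmod z)) as [[h|h]|h].
  - left; apply exp_increasing; auto.
  - rewrite h; lra.
  - exfalso.
    assert (Hx : Rabs x <= Cmod z) by (eapply Rle_trans; [apply Rmax_l|apply Rmax_Cmod]).
    pose proof (Rle_abs (- x)) as Hx'; rewrite Rabs_Ropp in Hx'.
    pose proof (Rabs_pos x); nra. }
assert (Hfin : forall s c, 0 <= s <= 1 -> Rabs c <= 2 * (Cmod z ^ S M / INR (fact M)) ->
   Rabs (exp (- (s * x)) * c) <= B).
{ intros s c Hs Hc; rewrite Rabs_mult, (Rabs_pos_eq (exp _)) by (left; apply exp_pos).
  apply Rmult_le_compat; auto using Rabs_pos; left; apply exp_pos. }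
split.
- pose (f s := exp (- (s * x)) * (cos (s * y) * exp_part_re z s M + sin (s * y) * exp_part_im z s M)).
  replace (exp (- x) * _ - 1) with (f 1 - f 0).
  2:{ unfold f; rewrite p0, q0, !Rmult_1_l, !Rmult_0_l, Ropp_0, exp_0, cos_0, sin_0; ring. }
  apply increment_bound with (fun s => exp (- (s * x)) *
     (- cos (s * y) * (fst (Cpow z (S M)) / INR (fact M) * s ^ M)
      + - sin (s * y) * (snd (Cpow z (S M)) / INR (fact M) * s ^ M))).
  + intros s _; destruct (exp_part_derive z s M) as [D1 D2]; fold x y in D1, D2.
    unfold f; evar_last.
    * apply (is_derive_mult (fun s => exp (- (s * x)))).
      -- auto_derive; auto.
      -- apply (is_derive_plus (V := R_NormedModule)).
         ++ apply (is_derive_mult (fun s => cos (s * y))); [auto_derive; auto|exact D1|].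
            intros; apply Rmult_comm.
         ++ apply (is_derive_mult (fun s => sin (s * y))); [auto_derive; auto|exact D2|].
            intros; apply Rmult_comm.
      -- intros; apply Rmult_comm.
    * cbv [plus mult]; simpl; ring.
  + intros s Hs; apply Hfin; auto.
    apply rotation_bound; rewrite ?Rabs_Ropp; auto using Rabs_cos_le, Rabs_sin_le.
- pose (f s := exp (- (s * x)) * (cos (s * y) * exp_part_im z s M - sin (s * y) * exp_part_re z s M)).
  replace (exp (- x) * _) with (f 1 - f 0).
  2:{ unfold f; rewrite p0, q0, !Rmult_1_l, !Rmult_0_l, Ropp_0, exp_0, cos_0, sin_0; ring. }
  apply increment_bound with (fun s => exp (- (s * x)) *
     (- cos (s * y) * (snd (Cpow z (S M)) / INR (fact M) * s ^ M)
      + sin (s * y) * (fst (Cpow z (S M)) / INR (fact M) * s ^ M))).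
  + intros s _; destruct (exp_part_derive z s M) as [D1 D2]; fold x y in D1, D2.
    unfold f; evar_last.
    * apply (is_derive_mult (fun s => exp (- (s * x)))).
      -- auto_derive; auto.
      -- apply (is_derive_minus (V := R_NormedModule)).
         ++ apply (is_derive_mult (fun s => cos (s * y))); [auto_derive; auto|exact D2|].
            intros; apply Rmult_comm.
         ++ apply (is_derive_mult (fun s => sin (s * y))); [auto_derive; auto|exact D1|].
            intros; apply Rmult_comm.
      -- intros; apply Rmult_comm.
    * cbv [plus mult minus opp]; simpl; ring.
  + intros s Hs; apply Hfin; auto.
    apply rotation_bound; rewrite ?Rabs_Ropp; auto using Rabs_cos_le, Rabs_sin_le.
Qed.

Lemma pow_fact_lim (x : R) : is_lim_seq (fun M => x ^ M / INR (fact M)) 0.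
Proof. apply is_lim_seq_Reals, cv_speed_pow_fact. Qed.

Lemma exp_part_lim (z : C) :
  is_lim_seq (fun M => exp_part_re z 1 M) (exp (fst z) * cos (snd z)) /\
  is_lim_seq (fun M => exp_part_im z 1 M) (exp (fst z) * sin (snd z)).
Proof.
set (x := fst z); set (y := snd z).
(* [U] and [V] are the real and imaginary parts of [exp (- z) T_M(z) - 1], where [T_M] is the Taylor
   polynomial; multiplication by [exp z] undoes the twist. *)
pose (U M := exp (- x) * (cos y * exp_part_re z 1 M + sin y * exp_part_im z 1 M) - 1).
pose (V M := exp (- x) * (cos y * exp_part_im z 1 M - sin y * exp_part_re z 1 M)).
assert (HB : is_lim_seq (fun M => exp (Cmod z) * (2 * (Cmod z ^ S M / INR (fact M)))) 0).
{ replace 0 with (exp (Cmod z) * 2 * Cmod z * 0) by ring.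
  apply is_lim_seq_ext with (fun M => exp (Cmod z) * 2 * Cmod z * (Cmod z ^ M / INR (fact M))).
  - intros M; simpl; field; apply INR_fact_neq_0.
  - apply (is_lim_seq_scal_l _ _ 0), pow_fact_lim. }
assert (HU : is_lim_seq U 0 /\ is_lim_seq V 0).
{ split; apply is_lim_seq_abs_0; refine (is_lim_seq_le_le (fun _ => 0) _ _ _ _ (is_lim_seq_const 0) HB);
  intros M; destruct (exp_part_twisted_bound z M); split; auto using Rabs_pos. }
destruct HU as [HU HV].
assert (He : exp x * exp (- x) = 1) by (rewrite <- exp_plus, Rplus_opp_r; apply exp_0).
pose proof (sin2_cos2 y) as Hsc; unfold Rsqr in Hsc.
split.
- apply is_lim_seq_ext with (fun M => exp x * cos y * (U M + 1) - exp x * sin y * V M).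
  + intros M; unfold U, V.
    transitivity ((exp x * exp (- x)) * (sin y * sin y + cos y * cos y) * exp_part_re z 1 M); [ring|].
    rewrite He, Hsc; ring.
  + replace (exp x * cos y) with (exp x * cos y * (0 + 1) - exp x * sin y * 0) at 1 by ring.
    apply is_lim_seq_minus'; apply (is_lim_seq_scal_l _ _ (Finite _)); auto.
    apply is_lim_seq_plus'; auto; apply is_lim_seq_const.
- apply is_lim_seq_ext with (fun M => exp x * sin y * (U M + 1) + exp x * cos y * V M).
  + intros M; unfold U, V.
    transitivity ((exp x * exp (- x)) * (sin y * sin y + cos y * cos y) * exp_part_im z 1 M); [ring|].
    rewrite He, Hsc; ring.
  + replace (exp x * sin y) with (exp x * sin y * (0 + 1) + exp x * cos y * 0) at 1 by ring.
    apply is_lim_seq_plus'; apply (is_lim_seq_scal_l _ _ (Finite _)); auto.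
    apply is_lim_seq_plus'; auto; apply is_lim_seq_const.
Qed.

Lemma ps_pow_below (c : nat -> R) (m n : nat) : c O = 0 -> (n < m)%nat -> ps_pow c m n = 0.
Proof.
intros H0; revert n; induction m as [|m IH]; intros n Hn; [lia|].
simpl; unfold ps_mul.
rewrite (sum_eq _ (fun _ => 0)); [apply sum_eq_R0; auto|].
intros [|i] Hi; [rewrite H0; ring|].
rewrite IH by lia; ring.
Qed.

Lemma ps_pow_nonneg (c : nat -> R) (m n : nat) :
  (forall k, 0 <= c k) -> 0 <= ps_pow c m n.
Proof.
intros H; revert n; induction m as [|m IH]; intros n; simpl.
- destruct n; lra.
- apply cond_pos_sum; intros k; apply Rmult_le_pos; auto.
Qed.

(** Unlike in [ps_exp], the cut-off [M] is the same for all coefficients, so this is a finite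
    combination of powers, to which [fourier_pow] applies. *)
Definition ps_exp_trunc (c : nat -> R) (M n : nat) : R :=
  sum_f_R0 (fun m => ps_pow c m n / INR (fact m)) M.

Lemma ps_exp_trunc_term_nonneg (c : nat -> R) (m n : nat) :
  (forall k, 0 <= c k) -> 0 <= ps_pow c m n / INR (fact m).
Proof.
intros H; apply Rmult_le_pos; [apply ps_pow_nonneg; auto|].
left; apply Rinv_0_lt_compat, INR_fact_lt_0.
Qed.

Lemma ps_exp_trunc_ge (c : nat -> R) (M n : nat) : c O = 0 -> (n <= M)%nat ->
  ps_exp_trunc c M n = ps_exp c n.
Proof.
intros H0 Hn; induction Hn as [|M Hn IH]; [reflexivity|].
unfold ps_exp_trunc in *; rewrite tech5, IH, ps_pow_below by (auto; lia).
unfold Rdiv; ring.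
Qed.

Lemma ps_exp_trunc_mono (c : nat -> R) (M M' n : nat) : (forall k, 0 <= c k) ->
  (M <= M')%nat -> ps_exp_trunc c M n <= ps_exp_trunc c M' n.
Proof.
intros H Hle; induction Hle as [|M' Hle IH]; [lra|].
unfold ps_exp_trunc in *; rewrite tech5.
pose proof (ps_exp_trunc_term_nonneg c (S M') n H); lra.
Qed.

Lemma ps_exp_trunc_le (c : nat -> R) (M n : nat) : c O = 0 -> (forall k, 0 <= c k) ->
  0 <= ps_exp_trunc c M n <= ps_exp c n.
Proof.
intros H0 H; split.
- apply cond_pos_sum; intros; apply ps_exp_trunc_term_nonneg; auto.
- destruct (Nat.le_gt_cases n M) as [h|h].
  + rewrite ps_exp_trunc_ge by auto; lra.
  + apply (ps_exp_trunc_mono c M n n); auto; lia.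
Qed.

Lemma fourier_0 (c : nat -> R) : fourier c 0 = (Series c, 0).
Proof.
unfold fourier, cosS, sinS; f_equal.
- apply Series_ext; intros n; rewrite Rmult_0_r, cos_0; ring.
- rewrite (Series_ext _ (fun k => 0 * c k)), Series_scal_l by
    (intros n; rewrite Rmult_0_r, sin_0; ring).
  ring.
Qed.

(** Evaluation on the unit circle is linear and multiplicative on summable series, hence commutes
    with the Taylor polynomial. *)
Lemma ps_exp_trunc_fourier (c : nat -> R) (M : nat) : summable c ->
  summable (ps_exp_trunc c M) /\
  forall t, fourier (ps_exp_trunc c M) t =
            (exp_part_re (fourier c t) 1 M, exp_part_im (fourier c t) 1 M).
Proof.
intros Hc.
assert (Hterm : forall m, summable (fun n => ps_pow c m n / INR (fact m))).
{ intros m; apply summable_le with (fun n => Rabs (/ INR (fact m) * ps_pow c m n)).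
  - intros n; right; f_equal; unfold Rdiv; ring.
  - apply summable_scal, summable_pow; auto. }
assert (Htf : forall m t, fourier (fun n => ps_pow c m n / INR (fact m)) t =
   (fst (Cpow (fourier c t) m) / INR (fact m) * 1 ^ m,
    snd (Cpow (fourier c t) m) / INR (fact m) * 1 ^ m)).
{ intros m t; rewrite pow1, !Rmult_1_r, <- fourier_pow by auto.
  unfold fourier, cosS, sinS; simpl; unfold Rdiv.
  rewrite <- !Series_scal_r; f_equal; apply Series_ext; intros n; ring. }
induction M as [|M [IH1 IH2]].
- split; [exact (Hterm O)|intros t; exact (Htf O t)].
- split; [exact (summable_plus _ _ IH1 (Hterm (S M)))|intros t].
  specialize (IH2 t); specialize (Htf (S M) t).
  unfold exp_part_re, exp_part_im in *; rewrite !tech5.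
  injection IH2 as <- <-.
  assert (H1 : cosS (fun n => ps_pow c (S M) n / INR (fact (S M))) t =
    fst (Cpow (fourier c t) (S M)) / INR (fact (S M)) * 1 ^ S M) by exact (f_equal fst Htf).
  assert (H2 : sinS (fun n => ps_pow c (S M) n / INR (fact (S M))) t =
    snd (Cpow (fourier c t) (S M)) / INR (fact (S M)) * 1 ^ S M) by exact (f_equal snd Htf).
  rewrite <- H1, <- H2.
  unfold fourier, cosS, sinS.
  rewrite <- !Series_plus by
    (try (apply summable_ex, summable_cos; auto; exact (Hterm (S M)));
     try (apply summable_ex, summable_sin; auto; exact (Hterm (S M)))).
  f_equal; apply Series_ext; intros n; unfold ps_exp_trunc; rewrite tech5; ring.
Qed.

(** Nonnegativity replaces an interchange of limits by two inequalities. The partial sum of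
    [ps_exp c] up to [K] is one of [ps_exp_trunc c K], hence at most the exponential; conversely
    every truncation lies termwise below [ps_exp c]. *)
Lemma ps_exp_series (c : nat -> R) : c O = 0 -> (forall k, 0 <= c k) -> summable c ->
  is_series (ps_exp c) (exp (Series c)) /\
  is_lim_seq (fun M => Series (ps_exp_trunc c M)) (exp (Series c)).
Proof.
intros H0 Hpos Hc.
assert (Htr : is_lim_seq (fun M => Series (ps_exp_trunc c M)) (exp (Series c))).
{ destruct (exp_part_lim (Series c, 0)) as [H _]; simpl in H.
  rewrite cos_0, Rmult_1_r in H.
  revert H; apply is_lim_seq_ext; intros M.
  destruct (ps_exp_trunc_fourier c M Hc) as [_ H].
  specialize (H 0); rewrite !fourier_0 in H; injection H; auto. }
split; auto.
assert (Hub : forall M, Series (ps_exp_trunc c M) <= exp (Series c)).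
{ intros M; apply (is_lim_seq_incr_compare (fun M => Series (ps_exp_trunc c M))); auto.
  intros n; apply Series_le.
  - intros k; destruct (ps_exp_trunc_le c n k H0 Hpos); split; auto.
    unfold ps_exp_trunc; rewrite tech5.
    pose proof (ps_exp_trunc_term_nonneg c (S n) k Hpos); lra.
  - apply summable_ex, ps_exp_trunc_fourier; auto. }
assert (Hps : forall K, sum_n (ps_exp c) K <= exp (Series c)).
{ intros K; eapply Rle_trans; [|apply (Hub K)].
  rewrite (sum_n_ext_loc _ (ps_exp_trunc c K)) by (intros; rewrite ps_exp_trunc_ge; auto).
  apply (is_lim_seq_incr_compare (sum_n (ps_exp_trunc c K))).
  - apply Series_correct, summable_ex, ps_exp_trunc_fourier; auto.
  - intros n; rewrite sum_Sn; cbv [plus]; simpl.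
    pose proof (ps_exp_trunc_le c K (S n) H0 Hpos); lra. }
assert (Hincr : forall n, sum_n (ps_exp c) n <= sum_n (ps_exp c) (S n)).
{ intros n; rewrite sum_Sn; cbv [plus]; simpl.
  pose proof (ps_exp_trunc_le c (S n) (S n) H0 Hpos).
  rewrite ps_exp_trunc_ge in H by auto; lra. }
destruct (ex_finite_lim_seq_incr _ _ Hincr Hps) as [L HL].
replace (exp (Series c)) with L; [exact HL|].
apply Rle_antisym.
- apply (is_lim_seq_le _ _ (Finite L) (Finite (exp (Series c))) Hps); auto; apply is_lim_seq_const.
- apply (is_lim_seq_le (fun M => Series (ps_exp_trunc c M)) (fun _ => L) (Finite (exp (Series c))) (Finite L)); auto;
    [|apply is_lim_seq_const].
  intros M; rewrite <- (is_series_unique _ _ HL).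
  apply Series_le; [intros; apply ps_exp_trunc_le; auto|eexists; exact HL].
Qed.

Lemma summable_ps_exp (c : nat -> R) : c O = 0 -> (forall k, 0 <= c k) -> summable c ->
  summable (ps_exp c).
Proof.
intros H0 Hpos Hc; destruct (ps_exp_series c H0 Hpos Hc) as [H _].
apply summable_le with (ps_exp c); [|eexists; exact H].
intros n; rewrite Rabs_pos_eq; [lra|].
pose proof (ps_exp_trunc_le c n n H0 Hpos); rewrite ps_exp_trunc_ge in H1 by auto; lra.
Qed.

(* On the unit circle the truncated exponentials converge at least as fast as at the point 1,
   all coefficients being nonnegative. *)
Lemma fourier_ps_exp (c : nat -> R) (t : R) :
  c O = 0 -> (forall k, 0 <= c k) -> summable c ->
  fourier (ps_exp c) t =
  (exp (cosS c t) * cos (sinS c t), exp (cosS c t) * sin (sinS c t)).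
Proof.
intros H0 Hpos Hc.
destruct (ps_exp_series c H0 Hpos Hc) as [HS Htr].
pose proof (summable_ps_exp c H0 Hpos Hc) as HSs.
destruct (exp_part_lim (fourier c t)) as [HC HD]; simpl fst in *; simpl snd in *.
assert (Hgap : is_lim_seq (fun M => Series (ps_exp c) - Series (ps_exp_trunc c M)) 0).
{ rewrite (is_series_unique _ _ HS).
  replace 0 with (exp (Series c) - exp (Series c)) by ring.
  apply is_lim_seq_minus'; auto; apply is_lim_seq_const. }
assert (Hg : forall (g : R -> R), (forall x, Rabs (g x) <= 1) -> forall M,
   Rabs (Series (fun k => ps_exp_trunc c M k * g (INR k * t)) - Series (fun k => ps_exp c k * g (INR k * t)))
   <= Series (ps_exp c) - Series (ps_exp_trunc c M)).
{ intros g Hg1 M.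
  destruct (ps_exp_trunc_fourier c M Hc) as [Hs _].
  assert (Hsg : forall b, summable b -> ex_series (fun k => b k * g (INR k * t))).
  { intros b Hb; apply summable_ex; apply summable_le with (2 := Hb).
    intros n; apply Rabs_mul_le; auto. }
  rewrite <- Series_minus by auto.
  rewrite <- Series_minus by (apply summable_ex; auto).
  assert (Hle : forall n, Rabs (ps_exp_trunc c M n * g (INR n * t) - ps_exp c n * g (INR n * t))
      <= ps_exp c n - ps_exp_trunc c M n).
  { intros n; replace (_ - _) with ((ps_exp_trunc c M n - ps_exp c n) * g (INR n * t)) by ring.
    eapply Rle_trans; [apply Rabs_mul_le; auto|].
    pose proof (ps_exp_trunc_le c M n H0 Hpos).
    rewrite Rabs_minus_sym, Rabs_pos_eq; lra. }
  assert (Hex : ex_series (fun n => ps_exp c n - ps_exp_trunc c M n)).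
  { apply (ex_series_minus (V := R_NormedModule)); apply summable_ex; auto. }
  eapply Rle_trans; [apply Series_Rabs|apply Series_le; auto].
  - exact (summable_le _ _ Hle Hex).
  - intros n; split; [apply Rabs_pos|auto]. }
assert (Hlim : forall g : R -> R, (forall x, Rabs (g x) <= 1) ->
   is_lim_seq (fun M => Series (fun k => ps_exp_trunc c M k * g (INR k * t)))
     (Series (fun k => ps_exp c k * g (INR k * t)))).
{ intros g Hg1.
  apply is_lim_seq_ext with (fun M => (Series (fun k => ps_exp_trunc c M k * g (INR k * t))
     - Series (fun k => ps_exp c k * g (INR k * t))) + Series (fun k => ps_exp c k * g (INR k * t)));
    [intros; ring|].
  set (S := Series (fun k => ps_exp c k * g (INR k * t))).
  cut (is_lim_seq (fun M => (Series (fun k => ps_exp_trunc c M k * g (INR k * t)) - S) + S) (0 + S));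
    [rewrite Rplus_0_l; auto|].
  apply is_lim_seq_plus'; [|apply is_lim_seq_const].
  apply is_lim_seq_abs_0.
  refine (is_lim_seq_le_le (fun _ => 0) _ _ _ _ (is_lim_seq_const 0) Hgap).
  intros M; split; [apply Rabs_pos|apply Hg; auto]. }
unfold fourier; f_equal.
- assert (E : Finite (cosS (ps_exp c) t) = Finite (exp (cosS c t) * cos (sinS c t))); [|injection E; auto].
  transitivity (Lim_seq (fun M => cosS (ps_exp_trunc c M) t));
    [symmetry; exact (is_lim_seq_unique _ _ (Hlim cos Rabs_cos_le))|].
  rewrite <- (is_lim_seq_unique _ _ HC).
  apply Lim_seq_ext; intros M.
  destruct (ps_exp_trunc_fourier c M Hc) as [_ H]; specialize (H t); injection H; auto.
- assert (E : Finite (sinS (ps_exp c) t) = Finite (exp (cosS c t) * sin (sinS c t))); [|injection E; auto].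
  transitivity (Lim_seq (fun M => sinS (ps_exp_trunc c M) t));
    [symmetry; exact (is_lim_seq_unique _ _ (Hlim sin Rabs_sin_le))|].
  rewrite <- (is_lim_seq_unique _ _ HD).
  apply Lim_seq_ext; intros M.
  destruct (ps_exp_trunc_fourier c M Hc) as [_ H]; specialize (H t); injection H; auto.
Qed.

(** * The coefficient integral *)

Lemma RInt_cos_int (m : Z) : is_RInt (fun t => cos (IZR m * t)) 0 PI (if Z.eq_dec m 0 then PI else 0).
Proof.
destruct (Z.eq_dec m 0) as [->|Hm].
- apply is_RInt_ext with (fun _ => 1).
  + intros x _; rewrite Rmult_0_l, cos_0; auto.
  + evar_last; [apply (is_RInt_const (V := R_NormedModule) 0 PI 1)|].
    cbv [scal]; simpl; cbv [mult]; simpl; ring.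
- assert (Hm' : IZR m <> 0) by (apply not_0_IZR; auto).
  evar_last.
  + apply (is_RInt_derive (fun t => sin (IZR m * t) / IZR m)).
    * intros x _; auto_derive; auto; field; auto.
    * intros x _; apply (ex_derive_continuous (fun t => cos (IZR m * t))); auto_derive; auto.
  + simpl; cbv [minus plus opp]; simpl.
    rewrite Rmult_0_r, sin_0, sin_eq_0_1 by (exists m; auto).
    unfold Rdiv; ring.
Qed.

(** The bound does not depend on the weights, so cosine weights at all angles [t] converge
    uniformly. *)
Lemma sum_n_Rabs_tail (c : nat -> R) (w : nat -> R) (M : nat) :
  summable c -> (forall k, Rabs (w k) <= 1) ->
  Rabs (Series (fun k => c k * w k) - sum_n (fun k => c k * w k) M) <=
  Series (fun k => Rabs (c k)) - sum_n (fun k => Rabs (c k)) M.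
Proof.
intros Hc Hw.
assert (Hcw : summable (fun k => c k * w k)).
{ apply summable_le with (2 := Hc); intros n; apply Rabs_mul_le; auto. }
rewrite !sum_n_Reals.
rewrite (Series_incr_n (fun k => c k * w k) (S M)) by (try lia; apply summable_ex; auto).
rewrite (Series_incr_n (fun k => Rabs (c k)) (S M)) by (try lia; auto).
simpl Init.Nat.pred.
replace (_ - _) with (Series (fun k => c (S M + k)%nat * w (S M + k)%nat)) by ring.
match goal with |- _ <= ?a + ?b - ?a => replace (a + b - a) with b by ring end.
assert (Hc' : ex_series (fun k => Rabs (c (S M + k)%nat))) by
  (apply (ex_series_incr_n (fun k => Rabs (c k)) (S M)); auto).
assert (Hle : forall n, Rabs (c (S M + n)%nat * w (S M + n)%nat) <= Rabs (c (S M + n)%nat))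
  by (intros n; apply Rabs_mul_le; auto).
eapply Rle_trans; [apply Series_Rabs; exact (summable_le _ _ Hle Hc')|].
apply Series_le; auto; intros n; split; auto using Rabs_pos.
Qed.

(** The integrand is the real part of [fourier c t] times [exp (- i N t)], that is, the sum of
    [c k cos ((k - N) t)]. It is even because [c] is real, so half a period suffices, and only
    [k = N] survives. *)
Lemma fourier_coef_RInt (c : nat -> R) (N : nat) : summable c ->
  is_RInt (fun t => cosS c t * cos (INR N * t) + sinS c t * sin (INR N * t)) 0 PI (PI * c N).
Proof.
intros Hc.
(* The frequency [k - N] may be negative, hence the passage to integers. *)
pose (w k t := cos (IZR (Z.of_nat k - Z.of_nat N) * t)).
assert (Hw : forall k t, w k t = cos (INR k * t) * cos (INR N * t) + sin (INR k * t) * sin (INR N * t)).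
{ intros k t; unfold w; rewrite minus_IZR, <- !INR_IZR_INZ, <- cos_minus; f_equal; ring. }
pose (f M t := sum_n (fun k => c k * w k t) M).
pose (h M := sum_n (fun k => c k * (if Z.eq_dec (Z.of_nat k - Z.of_nat N) 0 then PI else 0)) M).
destruct (filterlim_RInt f 0 PI eventually eventually_filter
  (fun t => Series (fun k => c k * w k t)) h) as [I [HI Hint]].
- intros M; unfold f, h; induction M as [|M IH].
  + rewrite sum_O; apply is_RInt_ext with (fun t => c O * w O t);
      [intros; rewrite sum_O; auto|].
    apply (is_RInt_scal (V := R_NormedModule)), RInt_cos_int.
  + rewrite sum_Sn.
    apply is_RInt_ext with (fun t => plus (sum_n (fun k => c k * w k t) M) (c (S M) * w (S M) t));
      [intros; rewrite sum_Sn; auto|].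
    apply (is_RInt_plus (V := R_NormedModule)); auto.
    apply (is_RInt_scal (V := R_NormedModule)), RInt_cos_int.
- apply filterlim_locally; intros eps.
  assert (Hlim := proj1 (filterlim_locally _ _) (Series_correct _ Hc) eps).
  revert Hlim; apply filter_imp; intros M HM t.
  change (Rabs (f M t - Series (fun k => c k * w k t)) < eps).
  rewrite Rabs_minus_sym; eapply Rle_lt_trans.
  + apply (sum_n_Rabs_tail c (fun k => w k t) M Hc); intros k; apply Rabs_cos_le.
  + change (Rabs (sum_n (fun k => Rabs (c k)) M - Series (fun k => Rabs (c k))) < eps) in HM.
    apply Rabs_lt_between in HM; lra.
- assert (HIN : I = PI * c N).
  { apply (filterlim_locally_unique (V := R_NormedModule) (F := eventually) h); [exact HI|].
    replace (PI * c N) with (h N).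
    - apply (is_series_finite (fun k => c k * (if Z.eq_dec (Z.of_nat k - Z.of_nat N) 0 then PI else 0))).
      intros k Hk; destruct Z.eq_dec; [lia|ring].
    - unfold h; destruct N as [|n].
      + rewrite sum_O; simpl; ring.
      + rewrite sum_Sn, (sum_n_ext_loc _ (fun _ => 0)), sum_n_const.
        * destruct Z.eq_dec; [cbv [plus]; simpl; ring|lia].
        * intros k Hk; destruct Z.eq_dec; [lia|apply Rmult_0_r]. }
  rewrite <- HIN; revert Hint; apply is_RInt_ext; intros t _.
  unfold cosS, sinS; rewrite <- !Series_scal_r, <- Series_plus.
  + apply Series_ext; intros k; rewrite Hw; ring.
  + apply (ex_series_scal_r (cos (INR N * t)) (fun k => c k * cos (INR k * t))),
      summable_ex, summable_cos; auto.
  + apply (ex_series_scal_r (sin (INR N * t)) (fun k => c k * sin (INR k * t))),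
      summable_ex, summable_sin; auto.
Qed.

Lemma coef_mul_exp_RInt (a h : nat -> R) (N : nat) :
  summable a -> h O = 0 -> (forall k, 0 <= h k) -> summable h ->
  is_RInt (fun t => exp (cosS h t) * (cosS a t * cos (sinS h t - INR N * t)
                                      - sinS a t * sin (sinS h t - INR N * t)))
    0 PI (PI * ps_mul a (ps_exp h) N).
Proof.
intros Ha H0 Hpos Hh.
pose proof (summable_ps_exp h H0 Hpos Hh) as He.
generalize (fourier_coef_RInt _ N (summable_mul _ _ Ha He)).
apply is_RInt_ext; intros t _.
rewrite cosS_mul, sinS_mul by auto.
pose proof (fourier_ps_exp h t H0 Hpos Hh) as E; unfold fourier in E.
injection E as -> ->.
rewrite cos_minus, sin_minus.
match goal with |- ?x = ?y => change (@eq R x y) end; ring.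
Qed.

(** * The Gaussian integral *)

Definition gauss (x : R) := RInt (fun s => exp (- s ^ 2)) 0 x.

Lemma gauss_fun_continuous (x : R) : continuous (fun s => exp (- s ^ 2)) x.
Proof. apply (ex_derive_continuous (fun s => exp (- s ^ 2))); auto_derive; auto. Qed.

Lemma gauss_fun_ex_RInt (a b : R) : ex_RInt (fun s => exp (- s ^ 2)) a b.
Proof. apply (ex_RInt_continuous (V := R_CompleteNormedModule)); intros; apply gauss_fun_continuous. Qed.

Lemma is_derive_gauss (x : R) : is_derive gauss x (exp (- x ^ 2)).
Proof.
apply (is_derive_RInt (fun s => exp (- s ^ 2)) gauss 0 x).
- apply filter_forall; intros y; apply (RInt_correct (V := R_CompleteNormedModule)), gauss_fun_ex_RInt.
- apply gauss_fun_continuous.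
Qed.

(** Integrand of the classical companion of [gauss x ^ 2]: the square and the integral of this
    function over [[0, 1]] have a constant sum, which evaluates the Gaussian integral without a
    double integral. *)
Definition gauss_tail (x s : R) := exp (- (x ^ 2 * (1 + s ^ 2))) / (1 + s ^ 2).

Lemma one_plus_sqr_pos (s : R) : 0 < 1 + s ^ 2.
Proof. nra. Qed.

Lemma gauss_tail_derive (x s : R) :
  is_derive (fun u => gauss_tail u s) x (-2 * x * exp (- (x ^ 2 * (1 + s ^ 2)))).
Proof.
pose proof (one_plus_sqr_pos s).
unfold gauss_tail; auto_derive; [lra|simpl in *; field; lra].
Qed.

Lemma gauss_tail_ex_RInt (x : R) : ex_RInt (gauss_tail x) 0 1.
Proof.
apply (ex_RInt_continuous (V := R_CompleteNormedModule)); intros s _.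
apply (ex_derive_continuous (gauss_tail x)).
pose proof (one_plus_sqr_pos s); unfold gauss_tail; auto_derive; lra.
Qed.

Lemma gauss_tail_RInt_derive (x : R) :
  is_derive (fun x => RInt (gauss_tail x) 0 1) x (-2 * exp (- x ^ 2) * gauss x).
Proof.
evar_last.
- apply is_derive_RInt_param.
  + apply filter_forall; intros y s _; eexists; apply gauss_tail_derive.
  + intros s _.
    apply continuity_2d_pt_ext with (fun u v => -2 * u * exp (- (u * u * (1 + v * v)))).
    * intros u v; symmetry; apply is_derive_unique; evar_last; [apply gauss_tail_derive|].
      do 4 f_equal; ring.
    * apply continuity_2d_pt_mult.
      -- apply continuity_2d_pt_mult; [apply continuity_2d_pt_const|apply continuity_2d_pt_id1].
      -- apply (continuity_1d_2d_pt_comp exp (fun u v => - (u * u * (1 + v * v)))).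
         ++ apply derivable_continuous_pt, derivable_pt_exp.
         ++ apply continuity_2d_pt_opp, continuity_2d_pt_mult.
            ** apply continuity_2d_pt_mult; apply continuity_2d_pt_id1.
            ** apply continuity_2d_pt_plus; [apply continuity_2d_pt_const|].
               apply continuity_2d_pt_mult; apply continuity_2d_pt_id2.
  + apply filter_forall; intros y; apply gauss_tail_ex_RInt.
(* The substitution [s -> x s] turns the integral over [[0, 1]] into [gauss x]; the factor [x] of
   the derivative is its Jacobian. *)
- pose proof (RInt_comp_lin (V := R_CompleteNormedModule) (fun s => exp (- s ^ 2)) x 0 0 1
    (gauss_fun_ex_RInt _ _)) as E.
  replace (x * 0 + 0) with 0 in E by ring; replace (x * 1 + 0) with x in E by ring.
  unfold gauss; rewrite <- E.
  change (RInt (fun s => Derive (fun u => gauss_tail u s) x) 0 1 =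
    scal (-2 * exp (- x ^ 2)) (RInt (fun s => scal x (exp (- (x * s + 0) ^ 2))) 0 1)).
  rewrite <- (RInt_scal (V := R_CompleteNormedModule)).
  + apply RInt_ext; intros s _; transitivity (-2 * x * exp (- (x ^ 2 * (1 + s ^ 2)))).
    * apply is_derive_unique, gauss_tail_derive.
    * replace (- (x ^ 2 * (1 + s ^ 2))) with (- x ^ 2 + - (x * s + 0) ^ 2) by ring.
      rewrite exp_plus; cbv [scal]; simpl; cbv [mult]; simpl; ring.
  + apply (ex_RInt_continuous (V := R_CompleteNormedModule)); intros s _.
    apply (ex_derive_continuous (fun s => x * exp (- (x * s + 0) ^ 2))); auto_derive; auto.
Qed.

Lemma gauss_tail_RInt_0 : RInt (gauss_tail 0) 0 1 = PI / 4.
Proof.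
rewrite <- atan_1; apply is_RInt_unique; evar_last.
- apply (is_RInt_derive atan).
  + intros s _; pose proof (one_plus_sqr_pos s).
    evar_last; [apply is_derive_Reals, derivable_pt_lim_atan|].
    unfold gauss_tail; rewrite pow_i, Rmult_0_l, Ropp_0, exp_0 by lia.
    unfold Rsqr; simpl; field; simpl in *; lra.
  + intros s _; apply (ex_derive_continuous (gauss_tail 0)).
    pose proof (one_plus_sqr_pos s); unfold gauss_tail; auto_derive; lra.
- rewrite atan_0; cbv [minus plus opp]; simpl; ring.
Qed.

(** The two derivatives, [2 gauss x exp (- x^2)] and its opposite, cancel, and at [0] the value is
    [atan 1]. *)
Lemma gauss_sqr (x : R) : gauss x ^ 2 + RInt (gauss_tail x) 0 1 = PI / 4.
Proof.
rewrite <- gauss_tail_RInt_0.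
pose (F x := gauss x ^ 2 + RInt (gauss_tail x) 0 1).
assert (HF : forall y, is_derive F y 0).
{ intros y; unfold F; evar_last.
  - apply (is_derive_plus (V := R_NormedModule)); [|apply gauss_tail_RInt_derive].
    apply (is_derive_pow gauss 2); apply is_derive_gauss.
  - cbv [plus]; simpl; ring. }
assert (E : F x = F 0).
{ destruct (MVT_gen F 0 x (fun _ => 0)) as [c [_ E]].
  - intros; apply HF.
  - intros; apply continuity_pt_filterlim, (ex_derive_continuous F); eexists; apply HF.
  - lra. }
unfold F in E; rewrite E; unfold gauss at 1; rewrite RInt_point.
cbv [zero]; simpl; ring.
Qed.

Lemma exp_le_exp (x y : R) : x <= y -> exp x <= exp y.
Proof. intros [H| ->]; [left; apply exp_increasing; auto|lra]. Qed.

(** The companion integrand lies between [0] and [exp (- x^2)], because [1 + s^2 >= 1] both in the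
    exponent and in the denominator. *)
Lemma gauss_bounds (x : R) : 0 <= x ->
  0 <= gauss x /\ PI / 4 - exp (- x ^ 2) <= gauss x ^ 2 <= PI / 4.
Proof.
intros Hx; pose proof (gauss_sqr x) as E.
assert (0 <= RInt (gauss_tail x) 0 1 <= exp (- x ^ 2)).
{ split.
  - apply RInt_ge_0; [lra|apply gauss_tail_ex_RInt|]; intros s _.
    pose proof (one_plus_sqr_pos s); unfold gauss_tail; left.
    apply Rdiv_lt_0_compat; auto; apply exp_pos.
  - replace (exp (- x ^ 2)) with (RInt (fun _ => exp (- x ^ 2)) 0 1).
    + apply RInt_le; [lra|apply gauss_tail_ex_RInt|apply ex_RInt_const|].
      intros s _; pose proof (one_plus_sqr_pos s); unfold gauss_tail.
      apply Rle_div_l; auto.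
      apply Rle_trans with (exp (- x ^ 2)).
      * apply exp_le_exp; nra.
      * pose proof (exp_pos (- x ^ 2)); nra.
    + rewrite RInt_const; cbv [scal]; simpl; cbv [mult]; simpl; ring. }
split; [|lra].
apply RInt_ge_0; auto; [apply gauss_fun_ex_RInt|]; intros; left; apply exp_pos.
Qed.

(** * The saddle-point estimate *)

Lemma nonneg_of_derive (f df : R -> R) (x : R) :
  (forall u, is_derive f u (df u)) -> (forall u, 0 <= u -> 0 <= df u) ->
  f 0 = 0 -> 0 <= x -> 0 <= f x.
Proof.
intros Hd Hp H0 Hx.
destruct (MVT_gen f 0 x df) as [c [Hc E]].
- intros; apply Hd.
- intros; apply continuity_pt_filterlim, (ex_derive_continuous f); eexists; apply Hd.
- rewrite Rmin_left, Rmax_right in Hc by lra.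
  rewrite H0 in E; pose proof (Hp c ltac:(lra)); nra.
Qed.

(** The bounds are integrated from [0] one after another: each auxiliary function vanishes there,
    and a bound already known makes its derivative nonnegative. The constants are not sharp. *)
Lemma trig_bounds (u : R) : 0 <= u ->
  Rabs (sin u) <= u /\ Rabs (cos u - 1) <= u /\ 1 - cos u <= u ^ 2 / 2 /\
  Rabs (sin u - u) <= u ^ 3 /\ Rabs (cos u - 1 + u ^ 2 / 2) <= u ^ 3.
Proof.
assert (s1 : forall u, 0 <= u -> 0 <= u - sin u).
{ intros x; apply (nonneg_of_derive (fun u => u - sin u) (fun u => 1 - cos u)).
  - intros y; auto_derive; auto; ring.
  - intros y _; pose proof (COS_bound y); lra.
  - rewrite sin_0; ring. }
assert (s1' : forall u, 0 <= u -> 0 <= u + sin u).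
{ intros x; apply (nonneg_of_derive (fun u => u + sin u) (fun u => 1 + cos u)).
  - intros y; auto_derive; auto; ring.
  - intros y _; pose proof (COS_bound y); lra.
  - rewrite sin_0; ring. }
assert (s2 : forall u, 0 <= u -> 0 <= cos u - 1 + u ^ 2 / 2).
{ intros x; apply (nonneg_of_derive (fun u => cos u - 1 + u ^ 2 / 2) (fun u => u - sin u)).
  - intros y; auto_derive; auto; simpl; field.
  - auto.
  - rewrite cos_0; simpl; field. }
assert (s2' : forall u, 0 <= u -> 0 <= u - 1 + cos u).
{ intros x; apply (nonneg_of_derive (fun u => u - 1 + cos u) (fun u => 1 - sin u)).
  - intros y; auto_derive; auto; ring.
  - intros y _; pose proof (SIN_bound y); lra.
  - rewrite cos_0; ring. }
assert (s3 : forall u, 0 <= u -> 0 <= u ^ 3 - u + sin u).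
{ intros x; apply (nonneg_of_derive (fun u => u ^ 3 - u + sin u) (fun u => 3 * u ^ 2 - 1 + cos u)).
  - intros y; auto_derive; auto; simpl; ring.
  - intros y Hy; pose proof (s2 y Hy); nra.
  - rewrite sin_0; ring. }
assert (s3' : forall u, 0 <= u -> 0 <= u ^ 2 - u + sin u).
{ intros x; apply (nonneg_of_derive (fun u => u ^ 2 - u + sin u) (fun u => 2 * u - 1 + cos u)).
  - intros y; auto_derive; auto; simpl; ring.
  - intros y Hy; pose proof (s2' y Hy); lra.
  - rewrite sin_0; ring. }
assert (s4 : forall u, 0 <= u -> 0 <= u ^ 3 - (cos u - 1 + u ^ 2 / 2)).
{ intros x; apply (nonneg_of_derive (fun u => u ^ 3 - (cos u - 1 + u ^ 2 / 2))
    (fun u => 3 * u ^ 2 + sin u - u)).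
  - intros y; auto_derive; auto; simpl; field.
  - intros y Hy; pose proof (s3' y Hy); nra.
  - rewrite cos_0; simpl; field. }
intros Hu; pose proof (COS_bound u).
specialize (s1 u Hu); specialize (s1' u Hu); specialize (s2 u Hu); specialize (s2' u Hu);
specialize (s3 u Hu); specialize (s4 u Hu).
repeat split; try apply Rabs_le; lra.
Qed.

Lemma exp_lipschitz (p q m : R) : p <= m -> q <= m ->
  Rabs (exp p - exp q) <= Rabs (p - q) * exp m.
Proof.
intros Hp Hq.
destruct (MVT_gen exp q p exp) as [c [Hc E]].
- intros; apply is_derive_exp.
- intros; apply derivable_continuous_pt, derivable_pt_exp.
- rewrite E, Rabs_mult, Rmult_comm, (Rabs_pos_eq (exp c)) by (left; apply exp_pos).
  apply Rmult_le_compat_l; [apply Rabs_pos|apply exp_le_exp].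
  eapply Rle_trans; [apply Hc|apply Rmax_lub; auto].
Qed.

(** One number that controls every remainder: [k^j <= k^3] for a natural number [k] and
    [j = 1, 2, 3], so the lower moments are dominated too. *)
Definition third_moment (c : nat -> R) := Series (fun k => Rabs (INR k ^ 3 * c k)).

Lemma moment_term_le (c : nat -> R) (j k : nat) : (1 <= j <= 3)%nat ->
  Rabs (INR k ^ j * c k) <= Rabs (INR k ^ 3 * c k).
Proof.
intros Hj; rewrite !Rabs_mult; apply Rmult_le_compat_r; [apply Rabs_pos|].
rewrite !Rabs_pos_eq by (apply pow_le, pos_INR).
(* At [k = 0] both powers vanish, as [j] is positive. *)
destruct k as [|k]; [simpl; rewrite !pow_i by lia; lra|].
apply Rle_pow; [apply (le_INR 1); lia|lia].
Qed.

Lemma summable_moment (c : nat -> R) (j : nat) : (1 <= j <= 3)%nat ->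
  summable (fun k => INR k ^ 3 * c k) -> summable (fun k => INR k ^ j * c k).
Proof.
intros Hj H; apply summable_le with (2 := H); intros k; apply moment_term_le; auto.
Qed.

(** [d] stands for a Taylor remainder of [sin] or [cos]; at [k t] its bound splits into [t^j] and
    [k^j], and the latter goes into the moment. *)
Lemma Series_small (c : nat -> R) (d : R -> R) (j : nat) (t : R) :
  (1 <= j <= 3)%nat -> 0 <= t -> summable (fun k => INR k ^ 3 * c k) ->
  (forall u, 0 <= u -> Rabs (d u) <= u ^ j) ->
  Rabs (Series (fun k => c k * d (INR k * t))) <= t ^ j * third_moment c.
Proof.
intros Hj Ht Hc Hd.
assert (Hle : forall k, Rabs (c k * d (INR k * t)) <= t ^ j * Rabs (INR k ^ 3 * c k)).
{ intros k; rewrite Rabs_mult.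
  assert (0 <= INR k * t) by (apply Rmult_le_pos; auto; apply pos_INR).
  apply Rle_trans with (Rabs (c k) * (INR k * t) ^ j).
  - apply Rmult_le_compat_l; auto using Rabs_pos.
  - pose proof (moment_term_le c j k Hj) as Hm.
    rewrite Rpow_mult_distr.
    rewrite Rabs_mult, (Rabs_pos_eq (INR k ^ j)) in Hm by (apply pow_le, pos_INR).
    pose proof (pow_le t j Ht); nra. }
assert (Hex : ex_series (fun k => t ^ j * Rabs (INR k ^ 3 * c k))) by
  exact (ex_series_scal (V := R_NormedModule) (t ^ j) _ Hc).
unfold third_moment; rewrite <- Series_scal_l.
eapply Rle_trans; [apply Series_Rabs; exact (summable_le _ _ Hle Hex)|].
apply Series_le; auto; intros n; split; auto using Rabs_pos.
Qed.

(** First order is enough for the series that do not carry the factor [N], namely those of f and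
    g_theta. *)
Lemma fourier_near_0 (c : nat -> R) (t : R) : 0 <= t -> summable c ->
  summable (fun k => INR k ^ 3 * c k) ->
  Rabs (cosS c t - Series c) <= t * third_moment c /\
  Rabs (sinS c t) <= t * third_moment c.
Proof.
intros Ht Hc H3; split; rewrite <- (pow_1 t) at 2.
- replace (cosS c t - Series c) with (Series (fun k => c k * (cos (INR k * t) - 1))).
  + apply (Series_small c (fun u => cos u - 1)); auto.
    intros u Hu; rewrite pow_1; apply trig_bounds; auto.
  + unfold cosS; rewrite <- Series_minus.
    * apply Series_ext; intros; ring.
    * apply summable_ex, summable_cos; auto.
    * apply summable_ex; auto.
- apply (Series_small c sin); auto.
  intros u Hu; rewrite pow_1; apply trig_bounds; auto.
Qed.

(** For the series multiplied by [N]: the linear term will cancel by the saddle-point equation, the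
    quadratic one becomes the Gaussian, and only [t^3] is left. *)
Lemma fourier_taylor (c : nat -> R) (t : R) : 0 <= t -> summable c ->
  summable (fun k => INR k ^ 3 * c k) ->
  Rabs (cosS c t - Series c + t ^ 2 / 2 * Series (fun k => INR k ^ 2 * c k)) <= t ^ 3 * third_moment c /\
  Rabs (sinS c t - t * Series (fun k => INR k * c k)) <= t ^ 3 * third_moment c.
Proof.
intros Ht Hc H3.
assert (H2 := summable_ex _ (summable_moment c 2 ltac:(lia) H3)).
assert (H1 : ex_series (fun k => INR k * c k)).
{ apply ex_series_ext with (fun k => INR k ^ 1 * c k); [intros; rewrite pow_1; auto|].
  apply summable_ex, summable_moment; auto. }
split.
- replace (cosS c t - _ + _) with
    (Series (fun k => c k * (cos (INR k * t) - 1 + (INR k * t) ^ 2 / 2))).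
  + apply (Series_small c (fun u => cos u - 1 + u ^ 2 / 2)); auto.
    intros u Hu; apply trig_bounds; auto.
  + unfold cosS; rewrite <- Series_minus, <- Series_scal_l, <- Series_plus.
    * apply Series_ext; intros; field.
    * apply (ex_series_minus (V := R_NormedModule)); apply summable_ex; auto using summable_cos.
    * exact (ex_series_scal (V := R_NormedModule) (t ^ 2 / 2) _ H2).
    * apply summable_ex, summable_cos; auto.
    * apply summable_ex; auto.
- replace (sinS c t - _) with (Series (fun k => c k * (sin (INR k * t) - INR k * t))).
  + apply (Series_small c (fun u => sin u - u)); auto.
    intros u Hu; apply trig_bounds; auto.
  + unfold sinS; rewrite <- Series_scal_l, <- Series_minus.
    * apply Series_ext; intros; ring.
    * apply summable_ex, summable_sin; auto.
    * exact (ex_series_scal (V := R_NormedModule) t _ H1).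
Qed.

Lemma RInt_t_gauss (m : R) : 0 < m -> 
  ex_RInt (fun t => t * exp (- (m * t ^ 2))) 0 PI /\
  RInt (fun t => t * exp (- (m * t ^ 2))) 0 PI <= / (2 * m).
Proof.
intros Hm.
assert (H : is_RInt (fun t => t * exp (- (m * t ^ 2))) 0 PI
   (minus (- / (2 * m) * exp (- (m * PI ^ 2))) (- / (2 * m) * exp (- (m * 0 ^ 2))))).
{ apply (is_RInt_derive (fun t => - / (2 * m) * exp (- (m * t ^ 2)))).
  - intros t _; auto_derive; auto; simpl; field; lra.
  - intros t _; apply (ex_derive_continuous (fun t => t * exp (- (m * t ^ 2)))); auto_derive; auto. }
split; [eexists; exact H|].
rewrite (is_RInt_unique _ _ _ _ H); cbv [minus plus opp]; simpl.
replace (- (m * (0 * (0 * 1)))) with 0 by ring; rewrite exp_0.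
pose proof (exp_pos (- (m * (PI * (PI * 1))))).
assert (0 < / (2 * m)) by (apply Rinv_0_lt_compat; lra); nra.
Qed.

Lemma RInt_gauss_scaled (lam : R) : 0 < lam ->
  is_RInt (fun t => exp (- (lam * t) ^ 2)) 0 PI (gauss (lam * PI) / lam).
Proof.
intros Hl.
evar_last.
- apply (is_RInt_ext (fun t => scal (/ lam) (scal lam (exp (- (lam * t + 0) ^ 2))))).
  + intros t _.
    change (/ lam * (lam * exp (- (lam * t + 0) ^ 2)) = exp (- (lam * t) ^ 2)).
    rewrite Rplus_0_r, <- Rmult_assoc, Rinv_l, Rmult_1_l by lra; reflexivity.
  + apply (is_RInt_scal (V := R_NormedModule)).
    apply (is_RInt_comp_lin (V := R_NormedModule) (fun s => exp (- s ^ 2))).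
    apply (RInt_correct (V := R_CompleteNormedModule)), gauss_fun_ex_RInt.
- rewrite Rmult_0_r, !Rplus_0_r; exact (Rmult_comm (/ lam) (gauss (lam * PI))).
Qed.

(** [gauss_bounds] controls the square of the normalized integral [y], and [|y - 1| <= |y^2 - 1|]
    for [y >= 0]. *)
Lemma gauss_scaled_limit (x : R) : 0 < x ->
  Rabs (2 / sqrt PI * gauss (x * PI) - 1) <= / x ^ 2.
Proof.
intros Hx.
pose proof PI_RGT_0 as HPI.
destruct (gauss_bounds (x * PI)) as [g0 [g1 g2]]; [nra|].
set (g := gauss (x * PI)) in *.
assert (Hs : 0 < sqrt PI) by (apply sqrt_lt_R0; auto).
assert (Hss : sqrt PI * sqrt PI = PI) by (apply sqrt_sqrt; lra).
set (y := 2 / sqrt PI * g).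
assert (Hy0 : 0 <= y).
{ unfold y; apply Rmult_le_pos; auto; apply Rlt_le, Rdiv_lt_0_compat; lra. }
assert (Hy2 : y * y = 4 / PI * g ^ 2).
{ unfold y; transitivity (4 / (sqrt PI * sqrt PI) * g ^ 2); [field; lra|].
  rewrite Hss; reflexivity. }
assert (He : exp (- (x * PI) ^ 2) <= / (x * PI) ^ 2).
{ rewrite exp_Ropp; apply Rinv_le_contravar; [apply pow_lt; nra|].
  pose proof (exp_ineq1_le ((x * PI) ^ 2)); lra. }
(* This amounts to [4 <= PI^3]. *)
assert (HP : 4 / PI * / (x * PI) ^ 2 <= / x ^ 2).
{ replace (4 / PI * / (x * PI) ^ 2) with (4 / (PI ^ 3) * / x ^ 2) by (field; lra).
  rewrite <- (Rmult_1_l (/ x ^ 2)) at 2.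
  apply Rmult_le_compat_r; [left; apply Rinv_0_lt_compat, pow_lt; auto|].
  apply Rle_div_l; [apply pow_lt; auto|].
  pose proof PI2_3_2; assert (3 <= PI) by lra; nra. }
assert (H4 : 0 < 4 / PI) by (apply Rdiv_lt_0_compat; lra).
assert (Hy1 : y * y <= 1).
{ rewrite Hy2; apply Rle_trans with (4 / PI * (PI / 4)); [nra|right; field; lra]. }
assert (Hy3 : 1 - / x ^ 2 <= y * y).
{ rewrite Hy2; apply Rle_trans with (4 / PI * (PI / 4 - / (x * PI) ^ 2)).
  - replace (4 / PI * (PI / 4 - / (x * PI) ^ 2)) with (1 - 4 / PI * / (x * PI) ^ 2) by (field; lra).
    lra.
  - apply Rmult_le_compat_l; lra. }
apply Rabs_le; split; nra.
Qed.

Lemma fourier_linear (a b : nat -> R) (x y t : R) : summable a -> summable b ->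
  cosS (fun k => x * (a k + y * b k)) t = x * (cosS a t + y * cosS b t) /\
  sinS (fun k => x * (a k + y * b k)) t = x * (sinS a t + y * sinS b t).
Proof.
intros Ha Hb; unfold cosS, sinS; split; rewrite <- Series_scal_l, <- Series_plus, <- Series_scal_l.
1, 4: apply Series_ext; intros; ring.
1, 3: apply summable_ex; auto using summable_cos, summable_sin.
1, 2: apply summable_ex, summable_scal; auto using summable_cos, summable_sin.
Qed.

Lemma Series_linear (a b : nat -> R) (x y : R) : summable a -> summable b ->
  Series (fun k => x * (a k + y * b k)) = x * (Series a + y * Series b).
Proof.
intros Ha Hb; rewrite <- Series_scal_l, <- Series_plus, <- Series_scal_l; auto.
- apply summable_ex; auto.
- apply summable_ex, summable_scal; auto.
Qed.

(* Here [exp p (A cos q - B sin q)] is the real part of the integrand and [S exp w] that of its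
   Gaussian model. *)
Lemma integrand_bound (A B S p q w m e1 e2 : R) :
  p <= m -> w <= m -> Rabs (A - S) <= e1 -> Rabs B <= e1 -> Rabs q <= e2 -> Rabs (p - w) <= e2 ->
  Rabs (exp p * (A * cos q - B * sin q) - S * exp w) <= exp m * (2 * e1 + 2 * Rabs S * e2).
Proof.
intros Hp Hw HA HB Hq Hpw.
assert (Hc : Rabs (cos q - 1) <= Rabs q).
{ unfold Rabs at 2; destruct Rcase_abs.
  - rewrite <- cos_neg; apply trig_bounds; lra.
  - apply trig_bounds; lra. }
pose proof (exp_lipschitz p w m Hp Hw) as He.
pose proof (exp_pos m) as Hm; pose proof (exp_pos p) as Hp0; pose proof (exp_le_exp _ _ Hp).
(* Telescoping: [A - S] and [B] cost [e1] each, while [cos q - 1] and [exp p - exp w] cost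
   [Rabs S * e2] each. *)
replace (exp p * (A * cos q - B * sin q) - S * exp w) with
  (exp p * ((A - S) * cos q + - (B * sin q) + S * (cos q - 1)) + S * (exp p - exp w)) by ring.
eapply Rle_trans; [apply Rabs_triang|].
replace (exp m * (2 * e1 + 2 * Rabs S * e2)) with
  (exp m * (2 * e1 + Rabs S * e2) + Rabs S * (e2 * exp m)) by ring.
pose proof (Rabs_pos S); pose proof (Rabs_pos (A - S)).
apply Rplus_le_compat.
- rewrite Rabs_mult, (Rabs_pos_eq (exp p)) by lra.
  apply Rmult_le_compat; try lra; try apply Rabs_pos.
  eapply Rle_trans; [apply Rabs_triang|].
  apply Rplus_le_compat.
  + eapply Rle_trans; [apply Rabs_triang|]; rewrite Rabs_Ropp.
    pose proof (Rabs_mul_le (A - S) (cos q) (Rabs_cos_le q)).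
    pose proof (Rabs_mul_le B (sin q) (Rabs_sin_le q)); lra.
  + rewrite Rabs_mult; apply Rmult_le_compat_l; lra.
- rewrite Rabs_mult; apply Rmult_le_compat_l; auto.
  eapply Rle_trans; [apply He|]; apply Rmult_le_compat_r; lra.
Qed.

(** Half of the exponent absorbs the factor [m t^2], since [x exp (- x) <= 1]; the other half stays
    for the integration. *)
Lemma cube_gauss_le (m t : R) : 0 < m -> 0 <= t ->
  m * t ^ 3 * exp (- (2 * m * t ^ 2)) <= t * exp (- (m * t ^ 2)).
Proof.
intros Hm Ht.
replace (- (2 * m * t ^ 2)) with (- (m * t ^ 2) + - (m * t ^ 2)) by ring.
rewrite exp_plus.
assert (H : m * t ^ 2 * exp (- (m * t ^ 2)) <= 1).
{ rewrite exp_Ropp; apply Rle_div_l; [apply exp_pos|].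
  pose proof (exp_ineq1_le (m * t ^ 2)); lra. }
pose proof (exp_pos (- (m * t ^ 2))).
replace (m * t ^ 3 * (exp (- (m * t ^ 2)) * exp (- (m * t ^ 2)))) with
  (t * exp (- (m * t ^ 2)) * (m * t ^ 2 * exp (- (m * t ^ 2)))) by ring.
rewrite <- (Rmult_1_r (t * exp _)) at 2.
apply Rmult_le_compat_l; auto; nra.
Qed.

(** The sequences [a], [tau], [om] stand for the coefficients of f, g_theta, g_kappa already
    multiplied by [r^k]. The equation [v * Series (fun k => INR k * om k) = 1] is the saddle-point
    equation, and [D] depends on [c], [V], [K] only, which is the source of uniformity. *)
Lemma saddle_estimate (c V K : R) : 0 < c ->
  exists D, forall (a tau om : nat -> R) (v : R) (N : nat),
  (1 <= N)%nat -> 0 < v <= V ->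
  summable a -> summable (fun k => INR k ^ 3 * a k) -> third_moment a <= K ->
  Rabs (Series a) <= K ->
  tau O = 0 -> (forall k, 0 <= tau k) ->
  summable tau -> summable (fun k => INR k ^ 3 * tau k) -> third_moment tau <= K ->
  om O = 0 -> (forall k, 0 <= om k) ->
  summable om -> summable (fun k => INR k ^ 3 * om k) -> third_moment om <= K ->
  v * Series (fun k => INR k * om k) = 1 ->
  (forall t, 0 <= t <= PI -> c * t ^ 2 <= v * (Series om - cosS om t)) ->
  Rabs (ps_mul a (ps_exp (fun k => v * (tau k + INR N * om k))) N
        * exp (- Series (fun k => v * (tau k + INR N * om k)))
        * sqrt (2 * PI * INR N * (v * Series (fun k => INR k ^ 2 * om k))) - Series a)
  <= D / sqrt (INR N).
Proof.
intros Hc.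
(* Factor of the pointwise bound [Hpt]: [2 K] pays for the variation of [a], and
   [2 K (V K) (1 + 2 / c)] for the error of the phase. *)
pose (L := 2 * K + 2 * K * (V * K) + 4 * K * (V * K) / c).
(* The first summand is the integrated error [L / (n c)] times [2 lam <= 2 sqrt n (1 + V K)]; the
   second pays for ending the Gaussian integral at [PI]. *)
exists ((2 * (1 + V * K) * L + K) / c).
intros a tau om v N HN Hv Ha Ha3 HaK HSK t0 tpos Ht Ht3 HtK o0 opos Ho Ho3 HoK Hmean Hdecay.
set (h := fun k => v * (tau k + INR N * om k)).
set (b2 := v * Series (fun k => INR k ^ 2 * om k)).
set (n := INR N).
assert (Hn : 1 <= n) by (apply (le_INR 1); auto).
pose proof PI_RGT_0 as HPI.
assert (HK : 0 <= K) by (pose proof (Rabs_pos (Series a)); lra).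
assert (HV : 0 < V) by lra.
assert (HVK : 0 <= V * K) by (apply Rmult_le_pos; lra).
assert (HL : 0 <= L).
{ unfold L; assert (0 <= 4 * K * (V * K) / c) by
    (apply Rmult_le_pos; [nra|left; apply Rinv_0_lt_compat; auto]); nra. }
assert (h0 : h O = 0) by (unfold h; rewrite t0, o0; ring).
assert (hpos : forall k, 0 <= h k).
{ intros k; apply Rmult_le_pos; [lra|]; pose proof (tpos k).
  assert (0 <= INR N * om k) by (apply Rmult_le_pos; auto using pos_INR); lra. }
assert (hs : summable h) by (apply summable_scal, summable_plus; auto; apply summable_scal; auto).
assert (HSh : Series h = v * (Series tau + n * Series om)) by (apply Series_linear; auto).
assert (Hm2 : 0 <= Series (fun k => INR k ^ 2 * om k) <= third_moment om).
{ assert (Hle : forall k, 0 <= INR k ^ 2 * om k <= Rabs (INR k ^ 3 * om k)).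
  { intros k.
    assert (0 <= INR k ^ 2 * om k) by (apply Rmult_le_pos; auto; apply pow_le, pos_INR).
    split; auto; rewrite <- (Rabs_pos_eq (INR k ^ 2 * om k)) by auto.
    apply moment_term_le; lia. }
  split; [|apply Series_le; auto].
  rewrite <- (Rmult_0_l (Series (fun k => INR k ^ 2 * om k))), <- Series_scal_l.
  apply Series_le; [intros k; destruct (Hle k); lra|].
  exact (summable_ex _ (summable_moment om 2 ltac:(lia) Ho3)). }
assert (Hb2 : b2 <= V * K) by (unfold b2; apply Rmult_le_compat; lra).
(* [1 - cos u <= u^2/2] turns the decay hypothesis into a lower bound for the variance. *)
assert (Hdec2 : 2 * c <= b2).
{ assert (Hs2 : ex_series (fun k => INR k ^ 2 * om k)) by
    exact (summable_ex _ (summable_moment om 2 ltac:(lia) Ho3)).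
  assert (H : Series om - cosS om 1 <= / 2 * Series (fun k => INR k ^ 2 * om k)).
  { unfold cosS; rewrite <- Series_minus, <- Series_scal_l.
    - apply Series_le.
      + intros k; pose proof (pos_INR k) as Hk.
        destruct (trig_bounds (INR k * 1)) as [_ [_ [H2 _]]]; [lra|].
        pose proof (COS_bound (INR k * 1)).
        split; [pose proof (opos k); nra|].
        replace (om k - om k * cos (INR k * 1)) with (om k * (1 - cos (INR k * 1))) by ring.
        replace (/ 2 * (INR k ^ 2 * om k)) with (om k * ((INR k * 1) ^ 2 / 2)) by field.
        apply Rmult_le_compat_l; auto.
      + exact (ex_series_scal (V := R_NormedModule) (/ 2) _ Hs2).
    - apply summable_ex; auto.
    - apply summable_ex, summable_cos; auto. }
  pose proof PI2_3_2.
  pose proof (Hdecay 1 ltac:(lra)) as H1; unfold b2; nra. }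
(* Chosen so that [(lam t)^2] is the quadratic term [n b2 t^2 / 2] of the phase. *)
pose (lam := sqrt (n * b2 / 2)).
assert (Hlam2 : lam ^ 2 = n * b2 / 2).
{ unfold lam; rewrite pow2_sqrt; auto; nra. }
assert (Hlam : 0 < lam) by (unfold lam; apply sqrt_lt_R0; nra).
pose (I := PI * ps_mul a (ps_exp h) N).
pose (f t := exp (- Series h) * (exp (cosS h t) * (cosS a t * cos (sinS h t - n * t)
                                      - sinS a t * sin (sinS h t - n * t)))).
assert (HI : is_RInt f 0 PI (exp (- Series h) * I)).
{ apply (is_RInt_scal (V := R_NormedModule)); apply coef_mul_exp_RInt; auto. }
assert (HG : is_RInt (fun t => Series a * exp (- (lam * t) ^ 2)) 0 PI (Series a * (gauss (lam * PI) / lam))).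
{ apply (is_RInt_scal (V := R_NormedModule)), RInt_gauss_scaled; auto. }
assert (Hmc : 0 < n * c / 2) by nra.
destruct (RInt_t_gauss (n * c / 2) Hmc) as [HEx HE].
(* The available decay is [exp (- n c t^2)]; half of its exponent is spent on the factor [n t^2] of
   the cubic remainder. *)
assert (Hpt : forall t, 0 < t < PI -> Rabs (f t - Series a * exp (- (lam * t) ^ 2)) <=
   L * (t * exp (- (n * c / 2 * t ^ 2)))).
{ intros t Htt.
  assert (E12 : cosS h t = v * (cosS tau t + n * cosS om t) /\
    sinS h t = v * (sinS tau t + n * sinS om t)) by exact (fourier_linear tau om v n t Ht Ho).
  destruct E12 as [E1 E2].
  destruct (fourier_near_0 a t ltac:(lra) Ha Ha3) as [A1 A2].
  destruct (fourier_near_0 tau t ltac:(lra) Ht Ht3) as [T1 T2].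
  destruct (fourier_taylor om t ltac:(lra) Ho Ho3) as [O1 O2].
  set (e2 := v * (t * third_moment tau + n * (t ^ 3 * third_moment om))).
  (* By [Hmean] the linear term of [v n sinS om t] is exactly [n t]. *)
  assert (Hq : Rabs (sinS h t - n * t) <= e2).
  { rewrite E2.
    replace (v * (sinS tau t + n * sinS om t) - n * t) with
      (v * (sinS tau t + n * (sinS om t - t * Series (fun k => INR k * om k))))
      by (replace (n * t) with (n * t * (v * Series (fun k => INR k * om k))) by (rewrite Hmean; ring); ring).
    unfold e2; rewrite Rabs_mult, (Rabs_pos_eq v) by lra.
    apply Rmult_le_compat_l; [lra|].
    eapply Rle_trans; [apply Rabs_triang|]; apply Rplus_le_compat; auto.
    rewrite Rabs_mult, (Rabs_pos_eq n) by lra; apply Rmult_le_compat_l; lra. }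
  assert (Hpw : Rabs ((cosS h t - Series h) - - (lam * t) ^ 2) <= e2).
  { rewrite E1, HSh, Rpow_mult_distr, Hlam2.
    replace (v * (cosS tau t + n * cosS om t) - v * (Series tau + n * Series om) -
      - (n * b2 / 2 * t ^ 2)) with
      (v * ((cosS tau t - Series tau) + 
        n * (cosS om t - Series om + t ^ 2 / 2 * Series (fun k => INR k ^ 2 * om k))))
      by (unfold b2; field).
    unfold e2; rewrite Rabs_mult, (Rabs_pos_eq v) by lra.
    apply Rmult_le_compat_l; [lra|].
    eapply Rle_trans; [apply Rabs_triang|]; apply Rplus_le_compat; auto.
    rewrite Rabs_mult, (Rabs_pos_eq n) by lra; apply Rmult_le_compat_l; lra. }
  assert (Hcosle : forall c : nat -> R, (forall k, 0 <= c k) -> summable c -> cosS c t <= Series c).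
  { intros d Hd Hds; unfold cosS.
    apply Rle_trans with (1 := Rle_abs _).
    apply Rle_trans with (1 := Series_Rabs _ (summable_cos d t Hds)).
    apply Series_le; [|apply summable_ex; auto].
    intros k; split; [apply Rabs_pos|].
    rewrite <- (Rabs_pos_eq (d k)) at 2 by auto; apply Rabs_mul_le, Rabs_cos_le. }
  (* All the decay comes from [om]; the series [tau] is nonnegative and can only help. *)
  assert (Hp : cosS h t - Series h <= - (n * c * t ^ 2)).
  { rewrite E1, HSh.
    pose proof (Hdecay t ltac:(lra)) as H1; pose proof (Hcosle tau tpos Ht) as H2.
    assert (n * (c * t ^ 2) <= n * (v * (Series om - cosS om t))) by (apply Rmult_le_compat_l; lra).
    assert (v * cosS tau t <= v * Series tau) by (apply Rmult_le_compat_l; lra).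
    lra. }
  (* By [2 c <= b2] the Gaussian model decays at least as fast. *)
  assert (Hw : - (lam * t) ^ 2 <= - (n * c * t ^ 2)).
  { rewrite Rpow_mult_distr, Hlam2; pose proof (pow2_ge_0 t).
    assert (n * c <= n * b2 / 2) by nra; nra. }
  pose proof (integrand_bound _ _ (Series a) _ _ _ _ _ _ Hp Hw A1 A2 Hq Hpw) as HB.
  replace (f t) with (exp (cosS h t - Series h) * (cosS a t * cos (sinS h t - n * t)
                                      - sinS a t * sin (sinS h t - n * t)))
    by (unfold f, Rminus at 1; rewrite exp_plus; ring).
  eapply Rle_trans; [exact HB|].
  set (E := exp (- (n * c * t ^ 2))).
  set (E' := exp (- (n * c / 2 * t ^ 2))).
  assert (HE0 : 0 < E) by apply exp_pos.
  assert (HEE : E <= E').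
  { apply exp_le_exp; pose proof (pow2_ge_0 t); nra. }
  assert (Hcube : n * t ^ 3 * E <= 2 / c * (t * E')).
  { pose proof (cube_gauss_le (n * c / 2) t Hmc ltac:(lra)) as H.
    replace (2 * (n * c / 2) * t ^ 2) with (n * c * t ^ 2) in H by field; fold E E' in H.
    replace (n * t ^ 3 * E) with (2 / c * (n * c / 2 * t ^ 3 * E)) by (field; lra).
    apply Rmult_le_compat_l; auto; left; apply Rdiv_lt_0_compat; lra. }
  assert (HtE : t * E <= t * E') by (apply Rmult_le_compat_l; lra).
  assert (Ee2 : E * e2 <= V * K * (1 + 2 / c) * (t * E')).
  { unfold e2.
    assert (0 <= n * t ^ 3 * E).
    { apply Rmult_le_pos; [|lra]; apply Rmult_le_pos; [lra|apply pow_le; lra]. }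
    assert (0 <= t * E) by (apply Rmult_le_pos; lra).
    replace (E * (v * (t * third_moment tau + n * (t ^ 3 * third_moment om)))) with
      (v * (t * E * third_moment tau + n * t ^ 3 * E * third_moment om)) by ring.
    apply Rle_trans with (v * (t * E * K + n * t ^ 3 * E * K)).
    - apply Rmult_le_compat_l; [lra|]; apply Rplus_le_compat; apply Rmult_le_compat_l; auto.
    - apply Rle_trans with (V * (K * (t * E' + 2 / c * (t * E')))); [|right; ring].
      replace (v * (t * E * K + n * t ^ 3 * E * K)) with (v * (K * (t * E + n * t ^ 3 * E))) by ring.
      apply Rmult_le_compat; try lra; [apply Rmult_le_pos; lra|].
      apply Rmult_le_compat_l; lra. }
  assert (Ee1 : E * (t * third_moment a) <= K * (t * E')).
  { apply Rle_trans with (t * E * K); [|nra].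
    replace (E * (t * third_moment a)) with (t * E * third_moment a) by ring.
    apply Rmult_le_compat_l; auto; apply Rmult_le_pos; lra. }
  assert (He20 : 0 <= e2) by (eapply Rle_trans; [apply Rabs_pos|exact Hq]).
  replace (E * (2 * (t * third_moment a) + 2 * Rabs (Series a) * e2)) with
    (2 * (E * (t * third_moment a)) + 2 * Rabs (Series a) * (E * e2)) by ring.
  apply Rle_trans with (2 * (K * (t * E')) + 2 * K * (V * K * (1 + 2 / c) * (t * E'))).
  - apply Rplus_le_compat; [lra|].
    apply Rmult_le_compat; auto.
    + pose proof (Rabs_pos (Series a)); lra.
    + apply Rmult_le_pos; lra.
    + lra.
  - unfold L; right; field; lra. }
assert (Hdiff : Rabs (exp (- Series h) * I - Series a * (gauss (lam * PI) / lam)) <= L / (n * c)).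
{ pose proof (is_RInt_minus (V := R_NormedModule) _ _ _ _ _ _ HI HG) as HD.
  change (is_RInt (fun t => f t - Series a * exp (- (lam * t) ^ 2)) 0 PI
    (exp (- Series h) * I - Series a * (gauss (lam * PI) / lam))) in HD.
  rewrite <- (is_RInt_unique _ _ _ _ HD).
  eapply Rle_trans; [apply abs_RInt_le; [lra|eexists; exact HD]|].
  eapply Rle_trans.
  - apply RInt_le with (g := fun t => L * (t * exp (- (n * c / 2 * t ^ 2)))).
    + lra.
    + apply (ex_RInt_norm (fun t => f t - Series a * exp (- (lam * t) ^ 2))).
      eexists; exact HD.
    + apply (ex_RInt_scal (V := R_NormedModule)); auto.
    + intros x Hx; apply Hpt; auto.
  - apply Rle_trans with (L * RInt (fun t => t * exp (- (n * c / 2 * t ^ 2))) 0 PI);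
      [right; exact (RInt_scal (V := R_CompleteNormedModule) _ _ _ L HEx)|].
    replace (L / (n * c)) with (L * / (2 * (n * c / 2))) by (field; lra).
    apply Rmult_le_compat_l; auto. }
pose proof (gauss_scaled_limit lam Hlam) as HGl.
assert (Hsp : 0 < sqrt PI) by (apply sqrt_lt_R0; auto).
assert (Hspp : sqrt PI * sqrt PI = PI) by (apply sqrt_sqrt; lra).
assert (Hsq : sqrt (2 * PI * n * b2) = 2 * lam * sqrt PI).
{ apply sqrt_lem_1; [|nra|].
  - apply Rmult_le_pos; [nra|lra].
  - transitivity (4 * lam ^ 2 * (sqrt PI * sqrt PI)); [ring|rewrite Hlam2, Hspp; field]. }
rewrite Hsq.
(* The error splits into that of the integrand and that of the truncated Gaussian integral; the
   normalizations match because [I] contains a factor [PI]. *)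
replace (ps_mul a (ps_exp h) N * exp (- Series h) * (2 * lam * sqrt PI) - Series a) with
  (2 * lam / sqrt PI * (exp (- Series h) * I - Series a * (gauss (lam * PI) / lam))
   + Series a * (2 / sqrt PI * gauss (lam * PI) - 1)).
2:{ unfold I.
    transitivity (2 * lam / sqrt PI *
      (exp (- Series h) * (sqrt PI * sqrt PI * ps_mul a (ps_exp h) N)) - Series a).
    - rewrite Hspp; field; lra.
    - field; lra. }
assert (Hsn : 0 < sqrt n) by (apply sqrt_lt_R0; lra).
assert (Hsnn : sqrt n * sqrt n = n) by (apply sqrt_sqrt; lra).
(* [1 + V K] is a root-free majorant of [sqrt (V K / 2)]. *)
assert (Hlamle : lam <= sqrt n * (1 + V * K)).
{ apply Rsqr_incr_0; [|lra|nra]; rewrite !Rsqr_pow2, Hlam2, Rpow_mult_distr.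
  rewrite pow2_sqrt by lra.
  apply Rle_trans with (n * (V * K / 2)).
  - unfold Rdiv; rewrite Rmult_assoc; apply Rmult_le_compat_l; lra.
  - apply Rmult_le_compat_l; [lra|nra]. }
assert (Hsp1 : 1 <= sqrt PI).
{ rewrite <- sqrt_1; apply sqrt_le_1_alt; pose proof PI2_3_2; lra. }
eapply Rle_trans; [apply Rabs_triang|].
apply Rle_trans with (2 * (sqrt n * (1 + V * K)) * (L / (n * c)) + K * (/ (c * sqrt n))).
- apply Rplus_le_compat.
  + rewrite Rabs_mult, (Rabs_pos_eq (2 * lam / sqrt PI)) by
      (apply Rmult_le_pos; [lra|left; apply Rinv_0_lt_compat; auto]).
    apply Rmult_le_compat; auto using Rabs_pos.
    * apply Rmult_le_pos; [lra|left; apply Rinv_0_lt_compat; auto].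
    * apply Rle_div_l; auto; nra.
  + rewrite Rabs_mult; apply Rmult_le_compat; auto using Rabs_pos.
    eapply Rle_trans; [exact HGl|].
    apply Rinv_le_contravar; [nra|].
    rewrite Hlam2; assert (sqrt n <= n).
    { assert (1 <= sqrt n) by (rewrite <- sqrt_1; apply sqrt_le_1_alt; auto).
      rewrite <- Hsnn at 2; nra. }
    nra.
- right; rewrite <- Hsnn; rewrite sqrt_square by lra; field; lra.
Qed.

(** * Decay of the real part of the phase *)

Lemma least_positive (P : nat -> Prop) (n : nat) : (0 < n)%nat -> P n ->
  exists m, (0 < m)%nat /\ P m /\ forall k, (k < m)%nat -> P k -> k = O.
Proof.
induction n as [n IH] using lt_wf_ind; intros Hn HP.
destruct (classic (exists k, (0 < k < n)%nat /\ P k)) as [[k [Hk Pk]]|H].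
- apply (IH k); tauto.
- exists n; repeat split; auto; intros k Hk Pk.
  destruct k; auto; exfalso; apply H; exists (S k); split; auto; lia.
Qed.

(* The [j] for which [|sin (j t / 2)|] is dominated by [D] are closed under addition and
   subtraction, so they are all multiples of the least positive one. *)
Lemma sin_half_dominated (om : nat -> R) (D : R -> R) :
  (~ exists j0 : nat, (1 < j0)%nat /\
      forall j : nat, (1 <= j)%nat -> om j <> 0 -> Nat.divide j0 j) ->
  (forall j, om j <> 0 -> exists B, 0 <= B /\ forall t, Rabs (sin (INR j * t)) <= B * D t) ->
  exists B, 0 <= B /\ forall t, Rabs (sin t) <= B * D t.
Proof.
intros Hna Hom.
pose (P j := exists B, 0 <= B /\ forall t, Rabs (sin (INR j * t)) <= B * D t).
assert (Pcomb : forall a b x y, P a -> P b ->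
   (forall t, Rabs (sin ((INR a + x * INR b) * t)) <= Rabs (sin (INR a * t)) + Rabs (sin (INR b * t))) ->
   (INR y = INR a + x * INR b) -> P y).
{ intros a b x y [A [HA1 HA2]] [B [HB1 HB2]] Ht Hy.
  exists (A + B); split; [lra|]; intros t.
  rewrite Hy, (Rmult_plus_distr_r A).
  eapply Rle_trans; [apply (Ht t)|]; apply Rplus_le_compat; auto. }
assert (Htri : forall a b s, s = 1 \/ s = -1 -> forall t,
   Rabs (sin ((a + s * b) * t)) <= Rabs (sin (a * t)) + Rabs (sin (b * t))).
{ intros a b s Hs t.
  replace ((a + s * b) * t) with (a * t + s * (b * t)) by ring; rewrite sin_plus.
  eapply Rle_trans; [apply Rabs_triang|]; apply Rplus_le_compat.
  - apply Rabs_mul_le, Rabs_cos_le.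
  - rewrite Rmult_comm.
    eapply Rle_trans; [apply Rabs_mul_le, Rabs_cos_le|].
    destruct Hs as [->| ->]; [rewrite Rmult_1_l; lra|].
    replace (-1 * (b * t)) with (- (b * t)) by ring.
    rewrite sin_neg, Rabs_Ropp; lra. }
assert (Padd : forall a b, P a -> P b -> P (a + b)%nat).
{ intros a b Pa Pb; apply (Pcomb a b 1); auto; rewrite plus_INR; ring. }
assert (Psub : forall a b, (b <= a)%nat -> P a -> P b -> P (a - b)%nat).
{ intros a b Hle Pa Pb; apply (Pcomb a b (-1)); auto; rewrite minus_INR by auto; ring. }
assert (P0 : P O).
{ exists 0; split; [lra|]; intros t; simpl; rewrite Rmult_0_l, sin_0, Rabs_R0; lra. }
assert (Pmul : forall k a, P a -> P (k * a)%nat).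
{ induction k; intros a Pa; simpl; auto. }
(* With empty support, [2] would vacuously divide all its elements. *)
assert (Hex : exists j, (1 <= j)%nat /\ om j <> 0).
{ apply NNPP; intros H; apply Hna; exists 2%nat; split; [lia|].
  intros j Hj Hj'; exfalso; apply H; eauto. }
destruct Hex as [j [Hj Hoj]].
destruct (least_positive P j) as [m [Hm [Pm Hmin]]]; [lia|apply Hom; auto|].
destruct (Nat.eq_dec m 1) as [->|Hm1].
- destruct Pm as [B [HB1 HB2]]; exists B; split; auto.
  intros t; specialize (HB2 t); rewrite Rmult_1_l in HB2; auto.
- exfalso; apply Hna; exists m; split; [lia|].
  (* The remainder [i mod m] is [i] minus a multiple of [m], hence dominated as well; being smaller
     than [m], it is [0]. *)
  intros i Hi Hoi; apply Nat.Lcm0.mod_divide, Hmin.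
  + apply Nat.mod_upper_bound; lia.
  + replace (i mod m)%nat with (i - (i / m) * m)%nat.
    * apply Psub; [|apply Hom; auto|apply Pmul; auto].
      rewrite Nat.mul_comm; apply Nat.Div0.mul_div_le.
    * rewrite (Nat.div_mod_eq i m) at 1; rewrite Nat.mul_comm; lia.
Qed.

(** The cubic bound is useful only for small arguments, so monotonicity first replaces [u] by
    [y = u / 4 <= 1/2], where [y - y^3 >= y / 2]. *)
Lemma sin_quarter_le (u : R) : 0 <= u <= PI / 2 -> u / 8 <= sin u.
Proof.
intros Hu; pose proof PI_RGT_0; pose proof PI_4.
apply Rle_trans with (sin (u / 4)).
- destruct (trig_bounds (u / 4)) as [_ [_ [_ [H3 _]]]]; [lra|].
  apply Rabs_le_between in H3.
  assert (0 <= u / 4 <= / 2) by lra.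
  set (y := u / 4) in *; replace (u / 8) with (y / 2) by (unfold y; field).
  assert (y ^ 3 <= y / 4) by (replace (y ^ 3) with (y * (y * y)) by ring; nra); lra.
- apply sin_incr_1; lra.
Qed.

Lemma term_le_Series (c : nat -> R) (j : nat) :
  (forall k, 0 <= c k) -> ex_series c -> c j <= Series c.
Proof.
intros Hc Hex.
apply Rle_trans with (sum_n c j).
- destruct j; [rewrite sum_O; lra|].
  rewrite sum_Sn, sum_n_Reals; pose proof (cond_pos_sum c j Hc).
  cbv [plus]; simpl; lra.
- apply (is_lim_seq_incr_compare (sum_n c)); [exact (Series_correct _ Hex)|].
  intros n; rewrite sum_Sn; pose proof (Hc (S n)); cbv [plus]; simpl; lra.
Qed.

(** Each term of the defect [G t] equals [2 om_j sin^2 (j t / 2)], so [|sin (j t / 2)|] is at most a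
    multiple of [sqrt (G t)] for [j] in the support. [sin_half_dominated] carries this over to
    [j = 1], where the sine is bounded below linearly. *)
Lemma cosS_decay (om : nat -> R) :
  (~ exists j0 : nat, (1 < j0)%nat /\
      forall j : nat, (1 <= j)%nat -> om j <> 0 -> Nat.divide j0 j) ->
  (forall k, 0 <= om k) -> summable om ->
  exists c, 0 < c /\ forall t, 0 <= t <= PI -> c * t ^ 2 <= Series om - cosS om t.
Proof.
intros Hna Hpos Hs.
pose (G t := Series om - cosS om t).
assert (HG : forall t, G t = Series (fun k => om k * (1 - cos (INR k * t)))).
{ intros t; unfold G, cosS; rewrite <- Series_minus.
  - apply Series_ext; intros; ring.
  - apply summable_ex; auto.
  - apply summable_ex, summable_cos; auto. }
assert (Hterm : forall t k, 0 <= om k * (1 - cos (INR k * t))).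
{ intros t k; pose proof (COS_bound (INR k * t)); pose proof (Hpos k); nra. }
assert (Hex : forall t, ex_series (fun k => om k * (1 - cos (INR k * t)))).
{ intros t; apply ex_series_ext with (fun k => om k - om k * cos (INR k * t)).
  { intros k; change (om k - om k * cos (INR k * t) = om k * (1 - cos (INR k * t))); ring. }
  apply (ex_series_minus (V := R_NormedModule)); apply summable_ex; auto using summable_cos. }
assert (Hge : forall t j, om j * (1 - cos (INR j * t)) <= G t).
{ intros t j; rewrite HG.
  apply (term_le_Series (fun k => om k * (1 - cos (INR k * t)))); auto. }
assert (HG0 : forall t, 0 <= G t).
{ intros t; apply Rle_trans with (2 := Hge t O); auto. }
destruct (sin_half_dominated om (fun t => sqrt (G (2 * t))) Hna) as [B [HB1 HB2]].
- intros j Hj.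
  assert (Hoj : 0 < om j) by (pose proof (Hpos j); lra).
  exists (/ sqrt (2 * om j)).
  assert (Hq : 0 < sqrt (2 * om j)) by (apply sqrt_lt_R0; lra).
  split; [left; apply Rinv_0_lt_compat; auto|].
  intros t; rewrite (Rmult_comm (/ _)); apply Rle_div_r; auto.
  rewrite <- sqrt_Rsqr_abs, <- sqrt_mult by (try apply Rle_0_sqr; lra).
  apply sqrt_le_1_alt.
  specialize (Hge (2 * t) j).
  replace (INR j * (2 * t)) with (2 * (INR j * t)) in Hge by ring.
  rewrite cos_2a_sin in Hge; unfold Rsqr; lra.
(* [256] is the square of the [16] in [t / 16 <= sin (t / 2)]; the added [1] avoids a division by
   zero when [B = 0]. *)
- exists (/ (256 * (B ^ 2 + 1))).
  assert (0 < B ^ 2 + 1) by nra.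
  split; [apply Rinv_0_lt_compat; nra|].
  intros t Ht.
  specialize (HB2 (t / 2)); replace (2 * (t / 2)) with t in HB2 by field.
  pose proof (sin_quarter_le (t / 2) ltac:(lra)) as Hsin.
  pose proof (Rle_abs (sin (t / 2))).
  assert (H1 : (t / 16) ^ 2 <= B ^ 2 * G t).
  { replace (B ^ 2 * G t) with ((B * sqrt (G t)) ^ 2) by
      (rewrite Rpow_mult_distr, pow2_sqrt; auto).
    apply pow_incr; lra. }
  fold (G t); rewrite (Rmult_comm (/ _)); apply Rle_div_l; [nra|].
  pose proof (HG0 t); nra.
Qed.

(** * Uniformity in the radius *)

(** The operator [z d/dz] on coefficients, which involves no shift of the index. *)
Definition index_mul (c : nat -> R) (k : nat) : R := INR k * c k.

Lemma index_mul_incr_derive (c : nat -> R) (k : nat) : index_mul c k = PS_incr_1 (PS_derive c) k.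
Proof.
destruct k; [exact (Rmult_0_l (c O))|reflexivity].
Qed.

Lemma CV_radius_index_mul (c : nat -> R) : CV_radius (index_mul c) = CV_radius c.
Proof.
rewrite (CV_radius_ext _ _ (index_mul_incr_derive c)), CV_radius_incr_1.
apply CV_radius_derive.
Qed.

Lemma PSeries_index_mul (c : nat -> R) (x : R) : Rbar_lt (Rabs x) (CV_radius c) ->
  PSeries (index_mul c) x = x * Derive (PSeries c) x.
Proof.
intros H; rewrite Derive_PSeries by auto.
rewrite <- PSeries_incr_1; apply PSeries_ext, index_mul_incr_derive.
Qed.

Lemma PSeries_index_mul2 (c : nat -> R) (x : R) : Rbar_lt (Rabs x) (CV_radius c) ->
  PSeries (index_mul (index_mul c)) x = x * Derive (PSeries c) x + x ^ 2 * Derive_n (PSeries c) 2 x.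
Proof.
intros H; rewrite PSeries_index_mul by (rewrite CV_radius_index_mul; auto).
assert (HD : ex_derive (Derive (PSeries c)) x) by (apply (ex_derive_n_PSeries 2 c x); auto).
(* The formula for one application holds in a neighbourhood of [x], so it may be differentiated
   there. *)
rewrite (Derive_ext_loc _ (fun y => y * Derive (PSeries c) y)).
- rewrite Derive_mult, Derive_id by (auto; apply ex_derive_id).
  simpl; ring_simplify; reflexivity.
- assert (Hloc : locally x (fun y => Rbar_lt (Rabs y) (CV_radius c))).
  { destruct (CV_radius c) as [R0| |]; simpl in H |- *; try tauto.
    - assert (0 < R0 - Rabs x) by lra.
      exists (mkposreal _ H0); intros y Hy.
      change (Rabs (y - x) < R0 - Rabs x) in Hy.
      pose proof (Rabs_triang_inv y x); lra.
    - exists (mkposreal 1 Rlt_0_1); auto. }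
  revert Hloc; apply filter_imp; intros y Hy; apply PSeries_index_mul; auto.
Qed.

Lemma summable_inside (c : nat -> R) (r : R) : Rbar_lt (Rabs r) (CV_radius c) ->
  summable (fun k => c k * r ^ k) /\ summable (fun k => INR k ^ 3 * (c k * r ^ k)).
Proof.
intros H; split; [exact (CV_disk_inside c r H)|].
apply summable_le with (fun k => Rabs (index_mul (index_mul (index_mul c)) k * r ^ k)).
- intros k; right; f_equal; unfold index_mul; ring.
- apply CV_disk_inside; rewrite !CV_radius_index_mul; auto.
Qed.

Lemma third_moment_mono (c : nat -> R) (r s : R) : 0 <= r <= s -> Rbar_lt s (CV_radius c) ->
  third_moment (fun k => c k * r ^ k) <= third_moment (fun k => c k * s ^ k).
Proof.
intros Hr Hs; apply Series_le.
- intros k; split; [apply Rabs_pos|]; rewrite !Rabs_mult.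
  rewrite !(Rabs_pos_eq (_ ^ _)) by (apply pow_le; try apply pos_INR; lra).
  pose proof (pow_incr r s k Hr); pose proof (pow_le (INR k) 3 (pos_INR k)).
  pose proof (Rabs_pos (c k)); apply Rmult_le_compat_l; auto; apply Rmult_le_compat_l; auto.
- apply summable_inside; rewrite Rabs_pos_eq by lra; auto.
Qed.

Lemma abs_Series_le (c : nat -> R) (r s : R) : 0 <= r <= s -> Rbar_lt s (CV_radius c) ->
  Rabs (Series (fun k => c k * r ^ k)) <= Series (fun k => Rabs (c k * s ^ k)).
Proof.
intros Hr Hs.
assert (Hss : summable (fun k => c k * s ^ k)) by
  (apply summable_inside; rewrite Rabs_pos_eq by lra; auto).
assert (Hle : forall k, Rabs (c k * r ^ k) <= Rabs (c k * s ^ k)).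
{ intros k; rewrite !Rabs_mult.
  rewrite !(Rabs_pos_eq (_ ^ _)) by (apply pow_le; lra).
  apply Rmult_le_compat_l; [apply Rabs_pos|]; apply pow_incr; auto. }
eapply Rle_trans; [apply Series_Rabs; exact (summable_le _ _ Hle Hss)|].
apply Series_le; auto; intros k; split; auto using Rabs_pos.
Qed.

Lemma ps_mul_ext (a b a' b' : nat -> R) (n : nat) :
  (forall k, a k = a' k) -> (forall k, b k = b' k) -> ps_mul a b n = ps_mul a' b' n.
Proof. intros Ha Hb; apply sum_eq; intros; rewrite Ha, Hb; auto. Qed.

(** The substitution [z -> r z] respects products; it is what carries the circle of radius [r] to
    the unit circle. *)
Lemma ps_mul_dilate (a b : nat -> R) (r : R) (n : nat) :
  ps_mul (fun k => a k * r ^ k) (fun k => b k * r ^ k) n = ps_mul a b n * r ^ n.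
Proof.
unfold ps_mul; rewrite (Rmult_comm _ (r ^ n)), scal_sum; apply sum_eq; intros i Hi.
replace (r ^ n) with (r ^ i * r ^ (n - i)) by (rewrite <- pow_add; f_equal; lia); ring.
Qed.

Lemma ps_pow_dilate (c : nat -> R) (r : R) (m n : nat) :
  ps_pow (fun k => c k * r ^ k) m n = ps_pow c m n * r ^ n.
Proof.
revert n; induction m as [|m IH]; intros n; simpl.
- destruct n; simpl; ring.
- rewrite <- ps_mul_dilate; apply ps_mul_ext; auto.
Qed.

Lemma ps_exp_dilate (c : nat -> R) (r : R) (n : nat) :
  ps_exp (fun k => c k * r ^ k) n = ps_exp c n * r ^ n.
Proof.
unfold ps_exp; rewrite (Rmult_comm _ (r ^ n)), scal_sum; apply sum_eq; intros i Hi.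
rewrite ps_pow_dilate; unfold Rdiv; ring.
Qed.

Lemma ps_pow_ext (c d : nat -> R) (m n : nat) :
  (forall k, c k = d k) -> ps_pow c m n = ps_pow d m n.
Proof.
intros H; revert n; induction m as [|m IH]; intros n; simpl; auto.
apply ps_mul_ext; auto.
Qed.

Lemma ps_exp_ext (c d : nat -> R) (n : nat) :
  (forall k, c k = d k) -> ps_exp c n = ps_exp d n.
Proof. intros H; apply sum_eq; intros; rewrite (ps_pow_ext c d); auto. Qed.

Lemma gcoef_nonneg (a : nat -> R) (k : nat) : (forall j, 0 <= a j) -> 0 <= gcoef a k.
Proof.
intros H; destruct k as [|k]; unfold gcoef; [lra|].
apply Rmult_le_pos; auto; left; apply Rinv_0_lt_compat, lt_0_INR; lia.
Qed.

Section Uniform.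

Context (theta kappa : nat -> R) (Rr : Rbar).
Hypothesis theta_nonneg : forall j, 0 <= theta j.
Hypothesis kappa_nonneg : forall j, 0 <= kappa j.
Hypothesis kappa_nonarith : non_arithmetic kappa.
Hypothesis radius_theta : CV_radius (gcoef theta) = Rr.
Hypothesis radius_kappa : CV_radius (gcoef kappa) = Rr.

Lemma gbr1_eq_Series (r : R) : 0 <= r -> Rbar_lt r Rr ->
  gbr1 kappa r = Series (fun k => INR k * (gcoef kappa k * r ^ k)).
Proof.
intros H0 Hr; unfold gbr1.
transitivity (PSeries (index_mul (gcoef kappa)) r).
- symmetry; apply PSeries_index_mul; rewrite Rabs_pos_eq, radius_kappa; auto.
- apply Series_ext; intros k; unfold index_mul; ring.
Qed.

Lemma b2_eq_Series (r : R) : 0 <= r -> Rbar_lt r Rr ->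
  b2 kappa r = Series (fun k => INR k ^ 2 * (gcoef kappa k * r ^ k)).
Proof.
intros H0 Hr; unfold b2, gbr1, gbr2.
transitivity (PSeries (index_mul (index_mul (gcoef kappa))) r).
- symmetry; apply PSeries_index_mul2; rewrite Rabs_pos_eq, radius_kappa; auto.
- apply Series_ext; intros k; unfold index_mul; ring.
Qed.

Lemma kappa_term_pos : exists j, (1 <= j)%nat /\ 0 < kappa j.
Proof.
apply NNPP; intros H; apply kappa_nonarith; exists 2%nat; split; [lia|].
intros j Hj Hj'; exfalso; apply H; exists j; split; auto.
pose proof (kappa_nonneg j); lra.
Qed.

Lemma gbr1_ex (r : R) : 0 <= r -> Rbar_lt r Rr ->
  ex_series (fun k => INR k * (gcoef kappa k * r ^ k)).
Proof.
intros H0 Hr.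
apply ex_series_ext with (fun k => INR k ^ 1 * (gcoef kappa k * r ^ k)); [intros; rewrite pow_1; auto|].
apply summable_ex, summable_moment; [lia|].
apply summable_inside; rewrite Rabs_pos_eq, radius_kappa; auto.
Qed.

Lemma gbr1_term_nonneg (r : R) (k : nat) : 0 <= r -> 0 <= INR k * (gcoef kappa k * r ^ k).
Proof.
intros H; apply Rmult_le_pos; [apply pos_INR|].
apply Rmult_le_pos; [apply gcoef_nonneg; auto|apply pow_le; auto].
Qed.

Lemma gbr1_increasing (r s : R) : 0 <= r < s -> Rbar_lt s Rr -> gbr1 kappa r < gbr1 kappa s.
Proof.
intros Hr Hs.
assert (Hr' : Rbar_lt r Rr) by (apply Rbar_lt_trans with s; auto; simpl; lra).
rewrite !gbr1_eq_Series by (auto; lra).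
destruct kappa_term_pos as [j [Hj Hk]].
assert (Hd : forall k, 0 <= INR k * (gcoef kappa k * s ^ k) - INR k * (gcoef kappa k * r ^ k)).
{ intros k; pose proof (pow_incr r s k ltac:(lra)).
  pose proof (gcoef_nonneg kappa k kappa_nonneg); pose proof (pos_INR k).
  replace (_ - _) with (INR k * (gcoef kappa k * (s ^ k - r ^ k))) by ring.
  apply Rmult_le_pos; auto; apply Rmult_le_pos; auto; lra. }
assert (Hdj : 0 < INR j * (gcoef kappa j * s ^ j) - INR j * (gcoef kappa j * r ^ j)).
{ destruct j as [|j]; [lia|].
  assert (0 < INR (S j)) by (apply lt_0_INR; lia).
  assert (0 < gcoef kappa (S j)) by (apply Rdiv_lt_0_compat; auto).
  assert (r ^ S j < s ^ S j).
  { pose proof (pow_incr r s j ltac:(lra)); pose proof (pow_lt s j ltac:(lra)).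
    pose proof (pow_le r j ltac:(lra)); simpl; nra. }
  replace (_ - _) with (INR (S j) * (gcoef kappa (S j) * (s ^ S j - r ^ S j))) by ring.
  apply Rmult_lt_0_compat; auto; apply Rmult_lt_0_compat; auto; lra. }
apply Rlt_0_minus.
rewrite <- Series_minus by (apply gbr1_ex; auto; lra).
apply Rlt_le_trans with (1 := Hdj).
apply (term_le_Series (fun k => INR k * (gcoef kappa k * s ^ k) - INR k * (gcoef kappa k * r ^ k))); auto.
apply (ex_series_minus (V := R_NormedModule)); apply gbr1_ex; auto; lra.
Qed.

Lemma gbr1_pos (r : R) : 0 < r -> Rbar_lt r Rr -> 0 < gbr1 kappa r.
Proof.
intros H Hr; apply Rle_lt_trans with (gbr1 kappa 0).
- unfold gbr1; rewrite Rmult_0_l; lra.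
- apply gbr1_increasing; auto; lra.
Qed.

Definition coefR (a : nat -> R) (N : nat) (v : R) : R :=
  ps_mul a (ps_exp (vGN_coef theta kappa N v)) N.

(** The parameter is the radius, with [v] as a function of it, so the interval [[ra, rb]] supplies
    all constants: the moments are largest at [rb] and the decay is weakest at [ra]. The error is
    additive, so the value of the series may be zero. *)
Lemma coefR_asymptotic (a : nat -> R) (ra rb : R) :
  0 < ra -> ra <= rb -> Rbar_lt rb Rr -> Rbar_lt rb (CV_radius a) ->
  exists D, forall (N : nat) (r : R), (1 <= N)%nat -> ra <= r <= rb ->
  let v := / gbr1 kappa r in
  Rabs (coefR a N v / (exp (v * GN theta kappa N r) /
           (r ^ N * sqrt (2 * PI * INR N * v * b2 kappa r)))
        - Series (fun k => a k * r ^ k)) <= D / sqrt (INR N).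
Proof.
intros Hra Hab Hrb Hrba.
assert (Hin : forall r, ra <= r <= rb -> Rbar_lt r Rr).
{ intros r Hr; apply Rbar_le_lt_trans with rb; auto; simpl; lra. }
assert (Hga : 0 < gbr1 kappa ra) by (apply gbr1_pos; auto; apply Hin; lra).
destruct (cosS_decay (fun k => gcoef kappa k * ra ^ k)) as [c0 [Hc0 Hdec]].
- intros [j0 [Hj0 Hdiv]]; apply kappa_nonarith; exists j0; split; auto.
  intros [|j] Hj Hk; [lia|]; apply Hdiv; auto.
  unfold gcoef; apply Rmult_integral_contrapositive_currified; [|apply pow_nonzero; lra].
  apply Rmult_integral_contrapositive_currified; auto.
  apply Rinv_neq_0_compat, not_0_INR; lia.
- intros k; apply Rmult_le_pos; [apply gcoef_nonneg; auto|apply pow_le; lra].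
- apply summable_inside; rewrite Rabs_pos_eq, radius_kappa by lra; apply Hin; lra.
- set (g := gbr1 kappa rb).
  assert (Hmono : forall r, ra <= r <= rb -> gbr1 kappa ra <= gbr1 kappa r <= g).
  { intros r Hr; split.
    - destruct (Req_dec ra r) as [->|]; [lra|left; apply gbr1_increasing; [lra|apply Hin; lra]].
    - unfold g; destruct (Req_dec r rb) as [->|]; [lra|left; apply gbr1_increasing; [lra|auto]]. }
  assert (Hg : 0 < g) by (pose proof (Hmono ra ltac:(lra)); lra).
  pose (M d := third_moment (fun k : nat => d k * rb ^ k)).
  pose (K := M a + M (gcoef theta) + M (gcoef kappa) + Series (fun k => Rabs (a k * rb ^ k))).
  assert (Hrb' : forall c, Rbar_lt rb (CV_radius c) -> Rbar_lt (Rabs rb) (CV_radius c))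
    by (intros c; rewrite Rabs_pos_eq by lra; auto).
  assert (Hrbt : Rbar_lt rb (CV_radius (gcoef theta))) by (rewrite radius_theta; auto).
  assert (Hrbk : Rbar_lt rb (CV_radius (gcoef kappa))) by (rewrite radius_kappa; auto).
  assert (HM : forall d, Rbar_lt rb (CV_radius d) -> 0 <= M d).
  { intros d Hd; apply Rle_trans with (2 := Series_Rabs _ (proj2 (summable_inside d rb (Hrb' d Hd)))).
    apply Rabs_pos. }
  pose proof (HM a Hrba) as HMa; pose proof (HM _ Hrbt) as HMt; pose proof (HM _ Hrbk) as HMk.
  assert (HS : 0 <= Series (fun k => Rabs (a k * rb ^ k))).
  { apply Rle_trans with (2 := Series_Rabs _ (proj1 (summable_inside a rb (Hrb' a Hrba)))).
    apply Rabs_pos. }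
  (* Since [gbr1] increases, [v] lies between [/ g] and [/ gbr1 kappa ra]: the lower end scales the
     decay constant, the upper end is [V]. *)
  destruct (saddle_estimate (c0 * / g) (/ gbr1 kappa ra) K) as [D HD].
  { apply Rmult_lt_0_compat; auto; apply Rinv_0_lt_compat; auto. }
  exists D; intros N r HN Hr v.
  pose proof (Hmono r Hr) as Hgr; pose proof (Hin r Hr) as Hrr.
  assert (Hv : / g <= v <= / gbr1 kappa ra) by (split; apply Rinv_le_contravar; lra).
  assert (Hg' : 0 < / g) by (apply Rinv_0_lt_compat; auto).
  assert (Hsum : forall c, Rbar_lt rb (CV_radius c) ->
    summable (fun k => c k * r ^ k) /\ summable (fun k => INR k ^ 3 * (c k * r ^ k))).
  { intros c H; apply summable_inside; rewrite Rabs_pos_eq by lra.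
    apply Rbar_le_lt_trans with rb; auto; simpl; lra. }
  assert (Hpos : forall c, (forall j, 0 <= c j) -> forall k, 0 <= gcoef c k * r ^ k).
  { intros c H k; apply Rmult_le_pos; [apply gcoef_nonneg; auto|apply pow_le; lra]. }
  assert (Hpos' : forall k, 0 <= gcoef kappa k * ra ^ k).
  { intros k; apply Rmult_le_pos; [apply gcoef_nonneg; auto|apply pow_le; lra]. }
  specialize (HD (fun k => a k * r ^ k) (fun k => gcoef theta k * r ^ k)
    (fun k => gcoef kappa k * r ^ k) v N HN).
  assert (Hest := HD ltac:(lra) (proj1 (Hsum a Hrba)) (proj2 (Hsum a Hrba))
    ltac:(apply Rle_trans with (M a); [apply third_moment_mono; auto; lra|unfold K; lra])
    ltac:(eapply Rle_trans; [apply (abs_Series_le a r rb); auto; lra|unfold K; lra])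
    ltac:(simpl; ring) (Hpos theta theta_nonneg)
    (proj1 (Hsum _ Hrbt)) (proj2 (Hsum _ Hrbt))
    ltac:(apply Rle_trans with (M (gcoef theta)); [apply third_moment_mono; auto; lra|unfold K; lra])
    ltac:(simpl; ring) (Hpos kappa kappa_nonneg)
    (proj1 (Hsum _ Hrbk)) (proj2 (Hsum _ Hrbk))
    ltac:(apply Rle_trans with (M (gcoef kappa)); [apply third_moment_mono; auto; lra|unfold K; lra])).
  clear HD; cbv beta in Hest.
  rewrite <- gbr1_eq_Series, <- b2_eq_Series in Hest by (auto; lra).
  specialize (Hest ltac:(unfold v; field; lra)).
  match type of Hest with ?A -> _ => assert (Hdec' : A) end.
  { intros t Ht; specialize (Hdec t Ht).
    (* Termwise: [1 - cos] is nonnegative and its coefficient grows with the radius. *)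
    assert (Hcmp : Series (fun k => gcoef kappa k * ra ^ k) - cosS (fun k => gcoef kappa k * ra ^ k) t <=
      Series (fun k => gcoef kappa k * r ^ k) - cosS (fun k => gcoef kappa k * r ^ k) t).
    { unfold cosS; pose proof (proj1 (Hsum _ Hrbk)) as Hs.
      assert (Hs' : summable (fun k => gcoef kappa k * ra ^ k)).
      { apply summable_inside; rewrite Rabs_pos_eq, radius_kappa by lra; apply Hin; lra. }
      rewrite <- !Series_minus by (apply summable_ex; auto using summable_cos).
      apply Series_le.
      - intros k; pose proof (COS_bound (INR k * t)); pose proof (Hpos' k).
        pose proof (pow_incr ra r k ltac:(lra)); pose proof (gcoef_nonneg kappa k kappa_nonneg).
        assert (gcoef kappa k * ra ^ k <= gcoef kappa k * r ^ k) by (apply Rmult_le_compat_l; auto).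
        split; nra.
      - apply (ex_series_minus (V := R_NormedModule)); apply summable_ex; auto using summable_cos. }
    pose proof (pow2_ge_0 t).
    apply Rle_trans with (v * (c0 * t ^ 2)); [|apply Rmult_le_compat_l; lra].
    replace (c0 * / g * t ^ 2) with (/ g * (c0 * t ^ 2)) by ring.
    apply Rmult_le_compat_r; [apply Rmult_le_pos; lra|lra]. }
  specialize (Hest Hdec'); clear Hdec'.
  replace (coefR a N v / (exp (v * GN theta kappa N r) /
           (r ^ N * sqrt (2 * PI * INR N * v * b2 kappa r)))) with
    (ps_mul (fun k => a k * r ^ k)
            (ps_exp (fun k => v * (gcoef theta k * r ^ k + INR N * (gcoef kappa k * r ^ k)))) N
     * exp (- Series (fun k => v * (gcoef theta k * r ^ k + INR N * (gcoef kappa k * r ^ k))))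
     * sqrt (2 * PI * INR N * (v * b2 kappa r))); [exact Hest|].
  rewrite (ps_mul_ext _ _ (fun k => a k * r ^ k) (fun k => ps_exp (vGN_coef theta kappa N v) k * r ^ k)).
  + rewrite ps_mul_dilate, Series_linear by (apply Hsum; auto).
    rewrite exp_Ropp; fold (coefR a N v).
    replace (2 * PI * INR N * (v * b2 kappa r)) with (2 * PI * INR N * v * b2 kappa r) by ring.
    change (Series (fun k => gcoef theta k * r ^ k) + INR N * Series (fun k => gcoef kappa k * r ^ k))
      with (GN theta kappa N r).
    unfold Rdiv; rewrite !Rinv_mult, !Rinv_inv; ring.
  + auto.
  + intros k; rewrite <- ps_exp_dilate; apply ps_exp_ext; intros j; unfold vGN_coef; ring.
Qed.

End Uniform.

(** * The cycle index *)

Module CycleIndex.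

Import ssreflect ssrfun ssrbool eqtype ssrnat seq choice fintype finset finfun bigop.
Import fingroup perm ssralg ssrnum poly Rstruct.

Import GRing.Theory Num.Theory GroupScope.
Set Implicit Arguments.
Unset Strict Implicit.
Unset Printing Implicit Defensive.

(** * Inserting a point into a cycle *)

Section Porbit.
Local Open Scope group_scope.
Variable T : finType.
Implicit Types (s : {perm T}) (S : {set T}).

Lemma porbit_subset s S x : x \in S -> (forall y, y \in S -> s y \in S) -> porbit s x \subset S.
Proof.
move=> xS cS; apply/subsetP=> y /porbitP[i ->].
by elim: i => [|i IH]; rewrite ?expg0 ?perm1 // expgSr permM cS.
Qed.

Lemma porbit_closed s x y : y \in porbit s x -> s y \in porbit s x.
Proof. by move=> /porbitP[i ->]; rewrite -permM -expgSr mem_porbit. Qed.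

Lemma porbit_fixed s x : s x = x -> porbit s x = [set x].
Proof.
move=> sx; apply/eqP; rewrite eqEsubset porbit_subset ?set11 //=; last first.
  by move=> y /set1P ->; rewrite sx set11.
by rewrite sub1set porbit_id.
Qed.

Variables (s' : {perm T}) (a b : T).
Hypotheses (ab : a != b) (s'b : s' b = b).
(** Products of permutations act from left to right, so [s] is [s'] with its fixed point [b]
    inserted directly after [a]. *)
Let s := tperm a b * s'.

Lemma tperm_mul_a : s a = b. Proof. by rewrite permM tpermL s'b. Qed.
Lemma tperm_mul_b : s b = s' a. Proof. by rewrite permM tpermR. Qed.
Lemma tperm_mul_other z : z != a -> z != b -> s z = s' z.
Proof. by move=> za zb; rewrite permM tpermD // eq_sym. Qed.

Lemma b_notin_porbit : b \notin porbit s' a.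
Proof. by rewrite porbit_sym porbit_fixed // inE. Qed.

Lemma porbit_tperm_mul : porbit s a = b |: porbit s' a.
Proof.
apply/eqP; rewrite eqEsubset; apply/andP; split.
  apply: porbit_subset => [|y]; first by rewrite !inE porbit_id orbT.
  have [->|ya] := eqVneq y a; first by move=> _; rewrite tperm_mul_a setU11.
  have [->|yb] := eqVneq y b.
    by move=> _; rewrite tperm_mul_b; apply: setU1r; apply: porbit_closed; apply: porbit_id.
  rewrite tperm_mul_other // !inE (negPf yb) /= => yP.
  by apply/orP; right; apply: porbit_closed.
have bP : b \in porbit s a by rewrite -{1}tperm_mul_a; apply: porbit_closed; apply: porbit_id.
rewrite subUset sub1set bP /=; apply: porbit_subset; first exact: porbit_id.
move=> y; have [->|ya] := eqVneq y a; first by move=> _; rewrite -tperm_mul_b; apply: porbit_closed.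
have [->|yb yP] := eqVneq y b; first by rewrite s'b.
by rewrite -tperm_mul_other //; apply: porbit_closed.
Qed.

Lemma porbit_tperm_mul_other c : c \notin porbit s a -> porbit s c = porbit s' c.
Proof.
rewrite porbit_tperm_mul !inE negb_or => /andP[cb ca].
have aP : a \notin porbit s' c by rewrite porbit_sym.
have bP : b \notin porbit s' c by rewrite porbit_sym porbit_fixed // inE.
have sub : porbit s c \subset porbit s' c.
  apply: porbit_subset => [|y yP]; first exact: porbit_id.
  by rewrite tperm_mul_other ?porbit_closed //; [apply: contraNneq aP|apply: contraNneq bP] => <-.
apply/eqP; rewrite eqEsubset sub; apply: porbit_subset => [|y yP]; first exact: porbit_id.
have yP' := subsetP sub _ yP.
by rewrite -tperm_mul_other ?porbit_closed //; [apply: contraNneq aP|apply: contraNneq bP] => <-.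
Qed.

(** Apart from the cycle of [a], both permutations have the same cycles; [b] leaves [A] because
    under [s'] it forms a cycle of its own. *)
Lemma porbits_tperm_mul (A : {set T}) : b \in A ->
  (porbit s @: A) :\ porbit s a = (porbit s' @: (A :\ b)) :\ porbit s' a.
Proof.
move=> bA; apply/setP=> X; rewrite !inE; apply/andP/andP=> -[XN /imsetP[c cA XE]]; subst X.
  have ca : c \notin porbit s a by rewrite -eq_porbit_mem.
  rewrite porbit_tperm_mul_other //; move: ca; rewrite porbit_tperm_mul !inE negb_or => /andP[cb ca].
  by rewrite eq_porbit_mem ca imset_f // !inE cb.
move: cA; rewrite !inE => /andP[cb cA].
have ca : c \notin porbit s a.
  by rewrite porbit_tperm_mul !inE negb_or cb -eq_porbit_mem.
by rewrite -porbit_tperm_mul_other // eq_porbit_mem ca imset_f.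
Qed.

End Porbit.

(** * Weighted sums over the permutations of a finite set *)

Section CycleSum.
Local Open Scope ring_scope.
Variables (R : comNzRingType) (x : nat -> R) (T : finType).
Implicit Types (A : {set T}) (s : {perm T}) (y : nat -> R).

(** Permutations of a subset [A] of a fixed type, so that deleting a point does not change the type;
    fixed points outside [A] carry no weight. *)
Definition cycle_sum A : R :=
  \sum_(s : {perm T} | perm_on A s) \prod_(X in porbit s @: A) x #|X|.

(** The cycle of [a] has its own weight [y], which can be shifted when that cycle loses a point. *)
Definition marked_cycle_sum y A a : R :=
  \sum_(s : {perm T} | perm_on A s)
    y #|porbit s a| * \prod_(X in (porbit s @: A) :\ porbit s a) x #|X|.

Lemma cycle_sum0 : cycle_sum set0 = 1.
Proof.
rewrite /cycle_sum (big_pred1 1%g) ?imset0 ?big_set0 // => s.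
apply/idP/eqP => [/perm_on_id -> //|->]; rewrite ?cards0 //; exact: perm_on1.
Qed.

Lemma cycle_sum_mark A a : a \in A -> cycle_sum A = marked_cycle_sum x A a.
Proof.
by move=> aA; apply: eq_bigr => s sA; rewrite (big_setD1 (porbit s a)) //= imset_f.
Qed.

Lemma perm_on_setD1 A a s : a \in A -> perm_on A s && (s a == a) = perm_on (A :\ a) s.
Proof.
move=> aA; apply/andP/idP => [[sA /eqP sa]|sA].
  apply/subsetP=> z; rewrite !inE => sz; rewrite (subsetP sA) // andbT.
  by apply: contraNneq sz => ->; rewrite sa.
split; first by apply: subset_trans sA (subsetDl _ _).
by apply/eqP/(out_perm sA); rewrite !inE eqxx.
Qed.

(* Deleting [b = s a] from the cycle of the marked point [a] shortens that cycle by one and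
   leaves the other cycles unchanged. *)
Lemma marked_cycle_sum_rec y A a : a \in A ->
  marked_cycle_sum y A a =
  y 1%N * cycle_sum (A :\ a) + \sum_(b in A :\ a) marked_cycle_sum (y \o succn) (A :\ b) a.
Proof.
move=> aA; rewrite /marked_cycle_sum.
rewrite (partition_big (fun s : {perm T} => s a) (mem A)) /=; last first.
  by move=> s sA; rewrite (perm_closed _ sA).
rewrite (big_setD1 a) //=; congr (_ + _).
  rewrite /cycle_sum big_distrr /=; apply: eq_big => [s|s]; first exact: perm_on_setD1.
  move=> /andP[sA /eqP sa]; rewrite porbit_fixed // cards1; congr (_ * _).
  apply: eq_bigl => X; rewrite !inE.
  apply/andP/imsetP => [[Xa /imsetP[c cA XE]]|[c]].
    exists c => //; rewrite !inE cA andbT; apply: contraNneq Xa => ca.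
    by rewrite XE ca porbit_fixed.
  rewrite !inE => /andP[ca cA] ->; split; last exact: imset_f.
  apply: contraNneq ca => E; have := porbit_id s c; by rewrite E inE.
apply: eq_bigr => b /setD1P[ba bA].
have ab : a != b by rewrite eq_sym.
(* Left multiplication by [tperm a b] maps the permutations of [A] that fix [b] bijectively onto
   those that send [a] to [b]. *)
rewrite (reindex_inj (mulgI (tperm a b))) /=; apply: eq_big => s.
  rewrite permM tpermL -perm_on_setD1 //; congr (_ && _).
  have tA : perm_on A (tperm a b).
    apply/subsetP=> z; rewrite inE; case: tpermP => [-> //|-> //|_ _]; by rewrite eqxx.
  apply/idP/idP => sA; last exact: perm_onM.
  by rewrite -[s](mulKg (tperm a b)) tpermV perm_onM.
move=> /andP[_]; rewrite permM tpermL => /eqP sb.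
rewrite porbits_tperm_mul // porbit_tperm_mul //.
by rewrite cardsU1 b_notin_porbit.
Qed.

Variable e : nat -> R.
Hypothesis e0 : e 0 = 1.
Hypothesis erec : forall n, e n.+1 *+ n.+1 = \sum_(i < n.+1) x i.+1 * e (n - i).

(** The induction needs all weights [y] at once, as the recursion passes to [y \o succn]; the case
    [y = x], combined with [erec], gives the first conclusion. *)
Lemma marked_cycle_sum_closed n A a y : #|A| = n.+1 -> a \in A ->
  cycle_sum A = e n.+1 *+ n.+1`! /\
  marked_cycle_sum y A a = (\sum_(i < n.+1) y i.+1 * e (n - i)) *+ n`!.
Proof.
elim: n A a y => [|n IH] A a y cA aA.
  have main z : marked_cycle_sum z A a = (\sum_(i < 1) z i.+1 * e (0 - i)) *+ 0`!.
    have A0 : A :\ a = set0 by apply/eqP; rewrite -cards_eq0 -(eqn_add2l (a \in A)) -cardsD1 cA aA.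
    by rewrite marked_cycle_sum_rec // A0 cycle_sum0 big_set0 addr0 big_ord1 e0.
  split=> //; by rewrite (cycle_sum_mark aA) main -erec.
have cD b : b \in A -> #|A :\ b| = n.+1.
  by move=> bA; apply/eqP; rewrite -(eqn_add2l (b \in A)) -cardsD1 cA bA.
have main z : marked_cycle_sum z A a = (\sum_(i < n.+2) z i.+1 * e (n.+1 - i)) *+ n.+1`!.
  rewrite marked_cycle_sum_rec //.
  have [c cAa] : exists c, c \in A :\ a by apply/set0Pn; rewrite -cards_eq0 cD.
  have [-> _] := IH _ c y (cD _ aA) cAa.
  rewrite big_ord_recl /= subn0 mulrnDl mulrnAr; congr (_ + _).
  (* All [n.+1] choices of [b] contribute equally, which turns [n!] into [(n+1)!]. *)
  rewrite (eq_bigr (fun=> (\sum_(i < n.+1) z i.+2 * e (n - i)) *+ n`!)).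
    by rewrite sumr_const cD // -mulrnA factS mulnC.
  move=> b /setD1P[ba bA].
  have aAb : a \in A :\ b by rewrite !inE eq_sym ba.
  by have [_ ->] := IH _ a (z \o succn) (cD _ bA) aAb.
split=> //; by rewrite (cycle_sum_mark aA) main -erec -mulrnA factS.
Qed.

Lemma cycle_sum_closed A : cycle_sum A = e #|A| *+ #|A|`!.
Proof.
case cA: #|A| => [|n].
  by move/eqP: cA; rewrite cards_eq0 => /eqP ->; rewrite cycle_sum0 e0.
have [a aA] : exists a, a \in A by apply/set0Pn; rewrite -cards_eq0 cA.
by have [] := marked_cycle_sum_closed x cA aA.
Qed.

End CycleSum.

(** * The recursion for the coefficients of an exponential *)

Section ExpRec.
Local Open Scope ring_scope.
Variables (F : numFieldType) (p : {poly F}) (N : nat).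
Hypothesis p0 : p`_0 = 0.

Lemma coef_exp_below m n : (n < m)%N -> (p ^+ m)`_n = 0.
Proof.
elim: m n => // m IH n nm; rewrite exprS coefM big1 // => -[i /= iN] _.
case: i iN => [|i] iN; first by rewrite p0 mul0r.
by rewrite IH ?mulr0 //; case: n nm iN => // n nm _; rewrite subSS (leq_ltn_trans (leq_subr _ _)).
Qed.

(* Coefficientwise form of [E' = p' E] for [E = exp p]. *)
Lemma exp_trunc_rec n : (n < N)%N ->
  let E := \sum_(m < N.+1) (m`!%:R)^-1 *: p ^+ m in
  E`_n.+1 *+ n.+1 = \sum_(j < n.+1) p`_j.+1 *+ j.+1 * E`_(n - j).
Proof.
move=> nN E.
(* The derivative of a truncated exponential lacks the top power [p ^+ N], whose coefficients below
   [N] vanish because [p] has no constant term. *)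
have dE : E^`() = p^`() * (E - (N`!%:R)^-1 *: p ^+ N).
  have -> : E - (N`!%:R)^-1 *: p ^+ N = \sum_(m < N) (m`!%:R)^-1 *: p ^+ m.
    by rewrite /E big_ord_recr /= addrK.
  rewrite raddf_sum big_ord_recl /= expr0 linearZ /= derivC scaler0 add0r.
  rewrite mulr_sumr; apply: eq_bigr => i _.
  rewrite linearZ /= deriv_exp /= -scalerAr [p^`() * _]mulrC -scaler_nat scalerA; congr (_ *: _).
  rewrite /bump /= add1n factS natrM invfM mulrAC mulVf ?mul1r // pnatr_eq0 //.
rewrite -coef_deriv dE coefM; apply: eq_bigr => j _.
rewrite coef_deriv coefB coefZ coef_exp_below ?mulr0 ?subr0 //.
exact: leq_ltn_trans (leq_subr _ _) nN.
Qed.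

End ExpRec.

(** * The cycle index as a coefficient of a formal exponential *)

Section StdlibReals.
Local Open Scope ring_scope.

Lemma fact_factorial n : Factorial.fact n = n`!.
Proof. by elim: n => // n IH; rewrite factS -IH. Qed.

Lemma sum_f_R0E (f : nat -> Rdefinitions.R) n : sum_f_R0 f n = \sum_(i < n.+1) f i.
Proof. by elim: n => [|n IH]; rewrite ?big_ord1 // big_ord_recr /= -IH. Qed.

Lemma ps_mulE (a b : nat -> Rdefinitions.R) n : ps_mul a b n = \sum_(i < n.+1) a i * b (n - i)%N.
Proof. by rewrite /ps_mul sum_f_R0E. Qed.

(** Coefficients up to [N] of a power depend only on the truncation of the series at degree [N]. *)
Lemma ps_powE (c : nat -> Rdefinitions.R) N m n : (n <= N)%N ->
  ps_pow c m n = ((\poly_(i < N.+1) c i) ^+ m)`_n.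
Proof.
elim: m n => [|m IH] n nN /=.
  by rewrite expr0 coef1; case: n nN.
rewrite ps_mulE exprS coefM; apply: eq_bigr => -[i /= iN] _.
rewrite coef_poly (leq_trans iN) //= IH // (leq_trans _ nN) ?leq_subr //.
Qed.

Lemma ps_exp_rec (x : nat -> Rdefinitions.R) n :
  ps_exp (gcoef x) n.+1 *+ n.+1 = \sum_(i < n.+1) x i.+1 * ps_exp (gcoef x) (n - i)%N.
Proof.
pose p := \poly_(i < n.+2) gcoef x i.
have p0 : p`_0 = 0 by rewrite coef_poly.
have E k : (k <= n.+1)%N ->
    ps_exp (gcoef x) k = (\sum_(m < n.+2) (m`!%:R)^-1 *: p ^+ m)`_k.
  move=> kn; rewrite -(@ps_exp_trunc_ge _ n.+1) //; last exact/leP.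
  rewrite /ps_exp_trunc sum_f_R0E coef_sum; apply: eq_bigr => i _.
  by rewrite coefZ -ps_powE // RdivE INRE fact_factorial mulrC.
rewrite E // exp_trunc_rec //; apply: eq_bigr => -[i /= iN] _.
rewrite -E ?(leq_trans (leq_subr _ _)) //; congr (_ * _).
rewrite coef_poly ltnS iN -[gcoef x i.+1]/(Rdiv (x i.+1) (INR i.+1)) RdivE INRE.
by rewrite -[LHS]mulr_natr divfK ?pnatr_eq0.
Qed.

Lemma cycle_index_exp (x : nat -> Rdefinitions.R) N :
  Rmult (Rinv (INR (Factorial.fact N)))
    (foldr Rplus (IZR Z0) (map (fun s : 'S_N =>
        foldr Rmult (IZR (Zpos xH)) (map (fun j => pow (x j) (ncycles s j)) (iota 1 N)))
        (enum 'S_N))) = ps_exp (gcoef x) N.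
Proof.
have e0 : ps_exp (gcoef x) 0 = 1 by rewrite /ps_exp /= /Rdiv Rinv_1 Rmult_1_r.
have := cycle_sum_closed e0 (@ps_exp_rec x) [set: 'I_N].
rewrite cardsT card_ord => H.
have -> : foldr Rplus (IZR Z0) (map (fun s : 'S_N =>
        foldr Rmult (IZR (Zpos xH)) (map (fun j => pow (x j) (ncycles s j)) (iota 1 N))) (enum 'S_N))
    = cycle_sum x [set: 'I_N].
  rewrite /cycle_sum.
  have -> l : foldr Rplus (IZR Z0) l = \sum_(r <- l) r
    by elim: l => [|r l IH]; rewrite ?big_nil // big_cons -IH.
  rewrite big_map big_enum /=; apply: eq_big => [s|s _].
    by apply/esym/subsetP => z; rewrite inE.
  have -> l : foldr Rmult (IZR (Zpos xH)) l = \prod_(r <- l) r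
    by elim: l => [|r l IH]; rewrite ?big_nil // big_cons -IH.
  rewrite big_map.
  have -> : porbit s @: [set: 'I_N] = porbits s.
    by apply/setP=> X; apply/imsetP/imsetP=> -[z _ ->]; exists z; rewrite ?inE.
  have card_le X : X \in porbits s -> (#|X| - 1 < N)%N /\ (0 < #|X|)%N.
    move=> /imsetP[z _ ->]; have h : (0 < #|porbit s z|)%N by apply/card_gt0P; exists z; exact: porbit_id.
    by split=> //; rewrite subn1 prednK // -[leqRHS](card_ord N) max_card.
  rewrite [LHS](_ : _ = \prod_(i < N) x i.+1 ^+ ncycles s i.+1); last first.
    have iotaE M : iota 1 M = index_iota 1 M.+1 by rewrite /index_iota subn1.
    by rewrite iotaE big_add1 big_mkord; apply: eq_bigr => i _; rewrite RpowE.
  (* Cycles are grouped by length minus one, as an element of an ordinal type; [inord] needs that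
     type nonempty, so [N = 0], where there are no cycles, is separate. *)
  case: N s card_le {H} => [|n] s card_le.
    rewrite big_ord0 big1 // => X /card_le[]; by rewrite ltn0.
  rewrite [RHS](partition_big (fun X : {set 'I_n.+1} => inord (#|X| - 1) : 'I_n.+1) predT) //=.
  apply: eq_bigr => i _.
  rewrite (eq_bigr (fun=> x i.+1)); last first.
    move=> X /andP[/card_le[h1 h2] /eqP <-]; by rewrite inordK // subn1 prednK.
  rewrite prodr_const; congr (_ ^+ _); apply: eq_card => X; rewrite !inE.
  apply: andb_id2l => /card_le[h1 h2].
  by rewrite -val_eqE /= inordK // subn1 -[RHS]eqSS prednK.
rewrite H RmultE RinvE INRE fact_factorial -[X in _ * X]mulr_natr mulrCA mulVf ?mulr1 //.
by rewrite pnatr_eq0 -lt0n fact_gt0.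
Qed.

End StdlibReals.

End CycleIndex.

Lemma HN_eq_ps_exp (theta kappa : nat -> R) (N : nat) :
  HN theta kappa N = ps_exp (vGN_coef theta kappa N 1) N.
Proof.
transitivity (ps_exp (gcoef (fun j => theta j + INR N * kappa j)) N).
- apply CycleIndex.cycle_index_exp.
- apply ps_exp_ext; intros k; unfold vGN_coef; destruct k as [|k]; unfold gcoef, Rdiv; ring.
Qed.

(** * The theorem *)

Lemma CV_radius_le (a b : nat -> R) : (forall n, Rabs (a n) <= Rabs (b n)) ->
  Rbar_le (CV_radius b) (CV_radius a).
Proof.
intros H; apply (proj2 (CV_radius_bounded b)).
intros r [M HM]; apply (proj1 (CV_radius_bounded a)).
exists M; intros n; apply Rle_trans with (2 := HM n).
rewrite !Rabs_mult; apply Rmult_le_compat_r; auto using Rabs_pos.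
Qed.

Lemma div_sqrt_small (D eps : R) : 0 < eps ->
  exists N0, (1 <= N0)%nat /\ forall N, (N0 <= N)%nat -> D / sqrt (INR N) < eps.
Proof.
intros He; destruct (INR_unbounded ((D / eps) ^ 2)) as [n Hn].
exists (S n); split; [lia|]; intros N HN.
assert (H : (D / eps) ^ 2 < INR N) by (apply le_INR in HN; rewrite S_INR in HN; lra).
assert (HN0 : 0 < INR N) by (pose proof (pow2_ge_0 (D / eps)); lra).
assert (Hs : 0 < sqrt (INR N)) by (apply sqrt_lt_R0; auto).
apply Rlt_div_l; auto; rewrite Rmult_comm; apply Rlt_div_l; auto.
apply Rle_lt_trans with (1 := Rle_abs _).
rewrite <- sqrt_Rsqr_abs, Rsqr_pow2; apply sqrt_lt_1_alt; split; auto using pow2_ge_0.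
Qed.

Lemma sum_n_C_re_im (a : nat -> C) (e : nat -> R) (N : nat) :
  sum_n (fun k => Cmult (a k) (RtoC (e k))) N =
  (sum_f_R0 (fun k => fst (a k) * e k) N, sum_f_R0 (fun k => snd (a k) * e k) N).
Proof.
induction N as [|N IH].
- rewrite sum_O; unfold Cmult, RtoC; simpl; f_equal; ring.
- rewrite sum_Sn, IH; unfold Cmult, RtoC, plus; simpl; unfold Cplus; simpl; f_equal; ring.
Qed.

Lemma coefN_re_im (a : nat -> C) (theta kappa : nat -> R) (N : nat) (v : R) :
  coefN a theta kappa N v =
  (coefR theta kappa (fun k => fst (a k)) N v, coefR theta kappa (fun k => snd (a k)) N v).
Proof. apply sum_n_C_re_im. Qed.

Lemma Cmod_le_sum (x y : R) : Cmod (x, y) <= Rabs x + Rabs y.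
Proof.
replace (x, y) with (Cplus (RtoC x) (Cmult Ci (RtoC y))) by
  (unfold Cplus, Cmult, Ci, RtoC; simpl; f_equal; ring).
eapply Rle_trans; [apply Cmod_triangle|].
rewrite Cmod_mult, !Cmod_R.
replace (Cmod Ci) with 1; [lra|].
unfold Cmod, Ci; simpl; rewrite <- sqrt_1 at 1; f_equal; ring.
Qed.

(** The ratio minus one equals [(z / X - f) / f], which turns additive errors of the two parts into
    a relative complex error. *)
Lemma Cdiv_minus_1_small (z f : C) (X m d : R) : 0 < X -> 0 < m -> m <= Cmod f ->
  Rabs (fst z / X - fst f) + Rabs (snd z / X - snd f) <= d ->
  Cmod (Cminus (Cdiv z (Cmult f (RtoC X))) (RtoC 1)) <= d / m.
Proof.
intros HX Hm Hf Hd.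
assert (Hf0 : f <> RtoC 0) by (intros ->; rewrite Cmod_0 in Hf; lra).
assert (HX0 : RtoC X <> RtoC 0) by (intros E; injection E; lra).
replace (Cminus (Cdiv z (Cmult f (RtoC X))) (RtoC 1)) with (Cdiv (fst z / X - fst f, snd z / X - snd f) f).
- rewrite Cmod_div by auto.
  apply Rle_trans with (d / Cmod f).
  + apply Rmult_le_compat_r; [left; apply Rinv_0_lt_compat; lra|].
    eapply Rle_trans; [apply Cmod_le_sum|exact Hd].
  + apply Rmult_le_compat_l; [|apply Rinv_le_contravar; auto].
    eapply Rle_trans; [|exact Hd]; pose proof (Rabs_pos (fst z / X - fst f));
    pose proof (Rabs_pos (snd z / X - snd f)); lra.
- replace (fst z / X - fst f, snd z / X - snd f) with (Cminus (Cdiv z (RtoC X)) f).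
  + field; split; [exact HX0|exact Hf0].
  + unfold Cdiv; rewrite <- RtoC_inv by lra; destruct z as [z1 z2], f as [f1 f2].
    unfold Cminus, Cplus, Copp, Cmult, RtoC; simpl; f_equal; field; lra.
Qed.

(** The squared modulus is continuous on a compact interval and attains its minimum, so pointwise
    nonvanishing becomes uniform. *)
Lemma fval_bounded_below (a : nat -> C) (ra rb : R) : 0 < ra <= rb ->
  Rbar_lt rb (CV_radius (fun k => fst (a k))) -> Rbar_lt rb (CV_radius (fun k => snd (a k))) ->
  (forall r, ra <= r <= rb -> fval a r <> RtoC 0) ->
  exists m, 0 < m /\ forall r, ra <= r <= rb -> m <= Cmod (fval a r).
Proof.
intros Hab Hre Him Hnz.
pose (h r := PSeries (fun k => fst (a k)) r ^ 2 + PSeries (fun k => snd (a k)) r ^ 2).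
destruct (continuity_ab_min h ra rb) as [r0 [Hmin Hr0]]; [lra| |].
- intros r Hr; unfold h.
  assert (Hin : forall c, Rbar_lt rb (CV_radius c) -> Rbar_lt (Rabs r) (CV_radius c)).
  { intros c Hc; rewrite Rabs_pos_eq by lra; apply Rbar_le_lt_trans with rb; auto; simpl; lra. }
  apply continuity_pt_plus.
  + apply (continuity_pt_comp (PSeries (fun k => fst (a k))) (fun x => x ^ 2)).
    * apply PSeries_continuity; auto.
    * apply derivable_continuous_pt, derivable_pt_pow.
  + apply (continuity_pt_comp (PSeries (fun k => snd (a k))) (fun x => x ^ 2)).
    * apply PSeries_continuity; auto.
    * apply derivable_continuous_pt, derivable_pt_pow.
- exists (Cmod (fval a r0)); split; [apply Cmod_gt_0; auto|].
  intros r Hr; apply sqrt_le_1_alt; apply (Hmin r Hr).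
Qed.

(** Termwise [k^2 >= k], so [b2] is at least [gbr1]. *)
Lemma b2_pos (kappa : nat -> R) (Rr : Rbar) (r : R) :
  (forall j, 0 <= kappa j) -> non_arithmetic kappa -> CV_radius (gcoef kappa) = Rr ->
  0 < r -> Rbar_lt r Rr -> 0 < b2 kappa r.
Proof.
intros Hk Hna HR Hr HrR.
apply Rlt_le_trans with (gbr1 kappa r); [apply (gbr1_pos kappa Rr); auto|].
rewrite (gbr1_eq_Series kappa Rr), (b2_eq_Series kappa Rr) by (auto; lra).
apply Series_le.
- intros k; pose proof (gbr1_term_nonneg kappa Hk r k ltac:(lra)); split; auto.
  destruct k as [|k]; [simpl; lra|].
  assert (1 <= INR (S k)) by (apply (le_INR 1); lia).
  replace (INR (S k) ^ 2 * (gcoef kappa (S k) * r ^ S k)) with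
    (INR (S k) * (INR (S k) * (gcoef kappa (S k) * r ^ S k))) by ring.
  nra.
- apply summable_ex, summable_moment; [lia|].
  apply summable_inside; rewrite Rabs_pos_eq, HR; auto; lra.
Qed.

Lemma saddle_normalization_pos (x y v b : R) (N : nat) : (1 <= N)%nat -> 0 < y -> 0 < v -> 0 < b ->
  0 < exp x / (y ^ N * sqrt (2 * PI * INR N * v * b)).
Proof.
intros HN Hy Hv Hb; apply Rdiv_lt_0_compat; [apply exp_pos|].
apply Rmult_lt_0_compat; [apply pow_lt; auto|].
pose proof PI_RGT_0; assert (0 < INR N) by (apply lt_0_INR; lia).
apply sqrt_lt_R0, Rmult_lt_0_compat, Hb; apply Rmult_lt_0_compat, Hv.
apply Rmult_lt_0_compat; lra.
Qed.

Lemma ps_mul_one (b c : nat -> R) (n : nat) : ps_mul (ps_pow c 0) b n = b n.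
Proof.
unfold ps_mul; destruct n as [|n]; [simpl; ring|].
rewrite decomp_sum by lia; simpl pred.
rewrite (sum_eq _ (fun _ => 0)), sum_eq_R0 by (auto; intros; simpl; ring).
simpl; ring.
Qed.

Theorem theorem3p3
  (theta kappa : nat -> R) (Rr : Rbar) (l : Rbar)
  (* standing assumptions *)
  (Htheta_nn : forall j : nat, (0 <= theta j)%R)
  (Hkappa_nn : forall j : nat, (0 <= kappa j)%R)
  (Hnonarith : non_arithmetic kappa)
  (Hkappa2 : exists j : nat, (2 <= j)%nat /\ (0 < kappa j)%R)
  (* both generating functions have radius of convergence R > 0 *)
  (HR_pos : Rbar_lt (Rbar.Finite 0) Rr)
  (HRtheta : CV_radius (gcoef theta) = Rr)
  (HRkappa : CV_radius (gcoef kappa) = Rr)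
  (* l = g_kappa^{1}(R) = lim_{r -> R^-} g_kappa^{1}(r), and 1 < l <= oo *)
  (Hl : filterlim (gbr1 kappa) (Rbar_at_left Rr) (Rbar_locally l))
  (Hl1 : Rbar_lt (Rbar.Finite 1) l) :
  (* main statement *)
  (forall (a : nat -> C) (v1 v2 : R) (rv : R -> R),
     (* f(z) = sum_k a_k z^k is holomorphic in |z| < R *)
     Rbar_le Rr (CV_radius (fun k => Cmod (a k))) ->
     (* constants v2 > 1 > v1 > 1 / g_kappa^{1}(R) *)
     (1 < v2)%R -> (v1 < 1)%R -> Rbar_lt (Rbar_inv l) (Rbar.Finite v1) ->
     (* r_v : the solution in (0, R) of g_kappa^{1}(r) = 1/v *)
     (forall v : R, (v1 <= v <= v2)%R ->
        (0 < rv v)%R /\ Rbar_lt (Rbar.Finite (rv v)) Rr /\ gbr1 kappa (rv v) = (/ v)%R) ->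
     (* the right-hand side is nonzero (f(r_v) <> 0) *)
     (forall v : R, (v1 <= v <= v2)%R -> fval a (rv v) <> RtoC 0) ->
     forall eps : R, (0 < eps)%R ->
     exists N0 : nat, forall (N : nat) (v : R), (N0 <= N)%nat -> (v1 <= v <= v2)%R ->
       (Cmod (Cminus
          (Cdiv (coefN a theta kappa N v)
             (Cmult (fval a (rv v))
                (RtoC (exp (v * GN theta kappa N (rv v)) /
                   (rv v ^ N * sqrt (2 * PI * INR N * v * b2 kappa (rv v)))))))
          (RtoC 1)) < eps)%R)
  /\
  (* in particular, for H_N *)
  (forall r1 : R,
     (0 < r1)%R -> Rbar_lt (Rbar.Finite r1) Rr -> gbr1 kappa r1 = 1%R ->
     forall eps : R, (0 < eps)%R ->
     exists N0 : nat, forall N : nat, (N0 <= N)%nat ->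
       (Rabs (HN theta kappa N /
          (exp (gfun theta r1 + INR N * gfun kappa r1) /
             (r1 ^ N * sqrt (2 * PI * INR N * b2 kappa r1))) - 1) < eps)%R).
Proof.
split.
- intros a v1 v2 rv Hrad Hv2 Hv1 _ Hrv Hnz eps Heps.
  assert (Hpos : forall v, v1 <= v <= v2 -> 0 < v).
  { intros v Hv; destruct (Hrv v Hv) as [h1 [h2 h3]].
    rewrite <- (Rinv_inv v), <- h3; apply Rinv_0_lt_compat.
    apply (gbr1_pos kappa Rr); auto. }
  assert (Hv1p := Hpos v1 ltac:(lra)).
  assert (Hinc := gbr1_increasing kappa Rr Hkappa_nn Hnonarith HRkappa).
  (* The endpoints are exchanged because [r_v] decreases as [v] grows. *)
  set (ra := rv v2); set (rb := rv v1).
  destruct (Hrv v2 ltac:(lra)) as [ra0 [raR rag]]; fold ra in ra0, raR, rag.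
  destruct (Hrv v1 ltac:(lra)) as [rb0 [rbR rbg]]; fold rb in rb0, rbR, rbg.
  assert (Hle : forall r s : R, 0 < r -> Rbar_lt s Rr -> gbr1 kappa s <= gbr1 kappa r ->
    0 < s -> s <= r).
  { intros r s Hr HsR Hg Hs; destruct (Rle_lt_dec s r) as [|Hlt]; auto.
    pose proof (Hinc r s ltac:(lra) HsR); lra. }
  assert (Hrange : forall v, v1 <= v <= v2 -> ra <= rv v <= rb).
  { intros v Hv; destruct (Hrv v Hv) as [h1 [h2 h3]]; pose proof (Hpos v Hv).
    split; apply Hle; auto; rewrite h3, ?rag, ?rbg; apply Rinv_le_contravar; lra. }
  assert (Hrab := Hrange v2 ltac:(lra)); fold ra in Hrab.
  assert (Hsurj : forall r : R, ra <= r <= rb -> exists v, v1 <= v <= v2 /\ rv v = r).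
  { intros r Hr.
    assert (HrR : Rbar_lt r Rr) by (apply Rbar_le_lt_trans with rb; auto; simpl; lra).
    assert (Hg : / v2 <= gbr1 kappa r <= / v1).
    { rewrite <- rag, <- rbg; split.
      - destruct (Req_dec ra r) as [->|]; [lra|left; apply Hinc; auto; lra].
      - destruct (Req_dec r rb) as [->|]; [lra|left; apply Hinc; auto; lra]. }
    assert (Hi2 : 0 < / v2) by (apply Rinv_0_lt_compat; lra).
    assert (Hv : v1 <= / gbr1 kappa r <= v2).
    { rewrite <- (Rinv_inv v1), <- (Rinv_inv v2); split; apply Rinv_le_contravar; lra. }
    exists (/ gbr1 kappa r); split; auto.
    destruct (Hrv _ Hv) as [h1 [h2 h3]]; rewrite Rinv_inv in h3.
    apply Rle_antisym; apply Hle; auto; lra. }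
  assert (Hcomp : forall p : C -> R, (forall z, Rabs (p z) <= Cmod z) ->
    Rbar_lt rb (CV_radius (fun k => p (a k)))).
  { intros p Hp; apply Rbar_lt_le_trans with Rr; auto.
    apply Rbar_le_trans with (1 := Hrad); apply CV_radius_le.
    intros n; rewrite (Rabs_pos_eq (Cmod _)) by apply Cmod_ge_0; auto. }
  assert (Hre := Hcomp fst (fun z => Rle_trans _ _ _ (Rmax_l _ _) (Rmax_Cmod z))).
  assert (Him := Hcomp snd (fun z => Rle_trans _ _ _ (Rmax_r _ _) (Rmax_Cmod z))).
  destruct (fval_bounded_below a ra rb) as [m [Hm Hlow]]; auto; try lra.
  { intros r Hr; destruct (Hsurj r Hr) as [v [Hv <-]]; auto. }
  destruct (coefR_asymptotic theta kappa Rr Htheta_nn Hkappa_nn Hnonarith HRtheta HRkappa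
    (fun k => fst (a k)) ra rb) as [D1 HD1]; auto; try lra.
  destruct (coefR_asymptotic theta kappa Rr Htheta_nn Hkappa_nn Hnonarith HRtheta HRkappa
    (fun k => snd (a k)) ra rb) as [D2 HD2]; auto; try lra.
  destruct (div_sqrt_small (D1 + D2) (eps * m)) as [N0 [HN0 Hsmall]]; [nra|].
  exists N0; intros N v HN Hv.
  destruct (Hrv v Hv) as [h1 [h2 h3]].
  assert (Hgv : / gbr1 kappa (rv v) = v) by (rewrite h3; apply Rinv_inv).
  specialize (HD1 N (rv v) ltac:(lia) (Hrange v Hv)).
  specialize (HD2 N (rv v) ltac:(lia) (Hrange v Hv)).
  cbv zeta in HD1, HD2; rewrite Hgv in HD1, HD2.
  apply Rle_lt_trans with ((D1 + D2) / sqrt (INR N) / m).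
  + apply Cdiv_minus_1_small; auto.
    * apply saddle_normalization_pos; auto; try lia.
      apply (b2_pos kappa Rr); auto.
    * rewrite coefN_re_im; unfold Rdiv at 5; rewrite Rmult_plus_distr_r.
      apply Rplus_le_compat; [exact HD1|exact HD2].
  + apply Rlt_div_l; auto.
- intros r1 Hr1 Hr1R Hg eps Heps.
  (* The case f = 1 and v = 1; an empty product of series is the constant series 1. *)
  pose (one := ps_pow (fun _ => 0) 0).
  assert (Hrad : Rbar_lt r1 (CV_radius one)).
  { apply Rbar_lt_le_trans with (r1 + 1); [simpl; lra|].
    apply (proj1 (CV_radius_bounded one)).
    exists 1; unfold one; intros [|n]; simpl;
      [rewrite Rmult_1_r, Rabs_R1; lra|rewrite Rmult_0_l, Rabs_R0; lra]. }
  destruct (coefR_asymptotic theta kappa Rr Htheta_nn Hkappa_nn Hnonarith HRtheta HRkappa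
    one r1 r1) as [D HD]; auto; try lra.
  destruct (div_sqrt_small D eps Heps) as [N0 [HN0 Hsmall]].
  exists N0; intros N Hge.
  apply Rle_lt_trans with (2 := Hsmall N Hge).
  specialize (HD N r1 ltac:(lia) ltac:(lra)); cbv zeta in HD.
  rewrite Hg, Rinv_1, Rmult_1_l, Rmult_1_r in HD.
  assert (Hone : Series (fun k => one k * r1 ^ k) = 1).
  { apply is_series_unique.
    evar_last; [apply (is_series_finite (fun k => one k * r1 ^ k) 0)|rewrite sum_O; apply Rmult_1_r].
    intros [|k] Hk; [lia|apply Rmult_0_l]. }
  rewrite Hone in HD.
  replace (HN theta kappa N) with (coefR theta kappa one N 1); [exact HD|].
  rewrite HN_eq_ps_exp; apply ps_mul_one.
Qed.
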